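(* Let $\sigma\colon S\curvearrowright A$ and $\tau\colon T\curvearrowright B$ be algebraic actions satisfying the standing assumptions, with globalizations $\tilde\sigma\colon\mathscr S\curvearrowright\mathscr A$ and $\tilde\tau\colon\mathscr T\curvearrowright\mathscr B$, and suppose that $\mathscr A$ and $\mathscr B$ are torsion-free. (i) If condition (I$_s$) holds and the groupoids $(\mathscr A\rtimes\mathscr S)\ltimes\overline A$ and $(\mathscr B\rtimes\mathscr T)\ltimes\overline B$ are isomorphic as topological groupoids, then $\dot\sigma\colon\mathscr S\curvearrowright\mathbb Q\otimes\mathscr A$ embeds into $\dot\tau\colon\mathscr T\curvearrowright\mathbb Q\otimes\mathscr B$ and $\dot\tau$ embeds into $\dot\sigma$. (ii) If condition ($*_s$) holds and $(S^{-1}A\rtimes S^{-1}S)\ltimes\overline A\cong(T^{-1}B\rtimes T^{-1}T)\ltimes\overline B$ as topological groupoids, then $\tilde\sigma\colon S^{-1}S\curvearrowright S^{-1}A$ embeds into $\tilde\tau\colon T^{-1}T\curvearrowright T^{-1}B$ and vice versa. If in addition $\mathscr A$ and $\mathscr B$ have finite rank, then in (i) both embeddings can be chosen full, and in (ii) both embeddings can be chosen of finite index. If in addition $\mathscr A$ and $\mathscr B$ have finite rank and both $\tilde\sigma$ and $\tilde\tau$ satisfy (SF), then in (i) there is a full and strict embedding of $\dot\sigma\colon\mathscr S\curvearrowright\mathbb Q\otimes\mathscr A$ into $\dot\tau\colon\mathscr T\curvearrowright\mathbb Q\otimes\mathscr B$ (i.e. the actions are isomorphic over $\mathbb Q$),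 and in (ii) there are strict finite index embeddings of $\tilde\sigma\colon S^{-1}S\curvearrowright S^{-1}A$ into $\tilde\tau\colon T^{-1}T\curvearrowright T^{-1}B$ and of $\tilde\tau$ into $\tilde\sigma$.
   Context: An algebraic action $\sigma\colon S\curvearrowright A$ consists of a left cancellative monoid $S$, an abelian group $A$ and a monoid homomorphism $s\mapsto\sigma_s$ from $S$ to the injective group endomorphisms of $A$. For $X\subseteq A$ put $\sigma_s^{-1}X=\{a\in A:\sigma_s(a)\in X\}$. The family $\mathcal C$ of constructible subgroups is the smallest family of subgroups of $A$ containing $A$ and closed under $C\mapsto\sigma_s(C)$ and $C\mapsto\sigma_s^{-1}(C)$ ($s\in S$). Standing assumptions: $\sigma$ is faithful ($s\mapsto\sigma_s$ injective), non-automorphic unless $S$ is a group (some $\sigma_s$ not surjective), satisfies (FI): $A/\sigma_s(A)$ is finite for all $s\in S$ (then each $C\in\mathcal C$ has finite index and $\overline A:=\varprojlim_{C\in\mathcal C}A/C$ is a compact group); and $\sigma$ has a globalization: a group $\mathscr S\supseteq S$ generated by $S$, an abelian group $\mathscr A\supseteq A$ generated by $\bigcup_{g\in\mathscr S}\tilde\sigma_g(A)$, and an action $\tilde\sigma$ of $\mathscr S$ on $\mathscr A$ by automorphisms with $\tilde\sigma_s|_A=\sigma_s$ ($s\in S$), satisfying (JF): if $C\in\mathcal C$, $g\in\mathscr S$ and $\tilde\sigma_g$ fixes $C$ pointwise, then $g=1$. The group $\mathscr A\rtimes\mathscr S$ acts on $\mathscr A$ by $(z,\gamma).x=z+\tilde\sigma_\gamma(x)$;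 restricting to $A$ gives a partial action on $A$ ($g$ acts by $A\cap g^{-1}.A\to g.A\cap A$), which under the standing assumptions extends uniquely to a partial action of $\mathscr A\rtimes\mathscr S$ on $\overline A$ by homeomorphisms between open sets; $(\mathscr A\rtimes\mathscr S)\ltimes\overline A$ denotes the associated partial transformation groupoid $\{(g,x):x\in\text{domain of }g\}$ (with $\mathscr A\rtimes\mathscr S$ discrete). The same notation ($T,B,\mathcal C_\tau,\overline B,\mathscr T,\mathscr B,\tilde\tau$) is used for $\tau$. Let $\dot\sigma_g={\rm id}_{\mathbb Q}\otimes\tilde\sigma_g$ on $\mathbb Q\otimes\mathscr A$, similarly $\dot\tau$. A group has finite rank if $\mathbb Q\otimes$ it is finite-dimensional. Embeddings: for actions $\rho\colon G\curvearrowright X$, $\rho'\colon H\curvearrowright Y$ of groups by automorphisms of abelian groups, an embedding of $\rho$ into $\rho'$ is a pair of injective homomorphisms $\mathfrak t\colon G\to H$, $\mathfrak b\colon X\to Y$ with $\mathfrak b(\rho_g(x))=\rho'_{\mathfrak t(g)}(\mathfrak b(x))$; it is of finite index if $\mathfrak b(X)$ has finite index in $Y$, full if $\mathfrak b$ is surjective, strict if $\mathfrak t$ is bijective. (SF) for $\tilde\sigma$ (with $\mathscr A$ torsion-free of finite rank): for $s,t\in\mathscr S$ and $\rho\in{\rm Aut}(\mathbb Q\otimes\mathscr A)$, $\dot\sigma_s=\rho\dot\sigma_t\rho^{-1}$ implies $s=t$. Condition (F) for $\tilde\tau$: ${\rm id}-\tilde\tau_t$ is injective on $\mathscr B$ for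 every $1\neq t\in\mathscr T$. Conditions for $\sigma$ relative to $\tau$, for a finite rank subgroup $\mathcal A'\subseteq A$: (i$_1$) there is $s\in S$ with $\sigma_s(\mathcal A')\subseteq\mathcal A'$, ${\rm id}-\sigma_s$ injective on $\mathcal A'$, and every subgroup of $\mathscr T$ generated by two elements is free or abelian; (i$_2$) there is $s\in S$ with $\sigma_s=\kappa\,{\rm id}_A$ for some $\kappa\in\mathbb Z\setminus\{0,1\}$, and every $\alpha\in\mathscr T$ conjugate in $\mathscr T$ to $\alpha^\kappa$ has finite order; (ii$_1$) for every integer $l>1$ that is the order of some torsion element of $\mathscr T$ there are $1\neq s_l\in S$ and coprime positive integers $\mu,\nu$ with $\sigma_{s_l}(\mathcal A')\subseteq\mathcal A'$, $\mu\det(z-{\rm id}_{\mathbb Q}\otimes\sigma_{s_l}|_{\mathcal A'})=\mu z^\delta-\nu$ for some $\delta$, and $\gcd(l,\mu)>1$ or $\gcd(l,\nu)>1$; (ii$_2$) condition (F) holds for $\tilde\tau$. (I): $A=\bigcup_n\mathcal A_n$ for an increasing sequence of finite rank subgroups, and either (i$_1$) holds for every $\mathcal A_n$ or (i$_2$) holds. (II): (ii$_1$) holds for every $\mathcal A_n$, or (ii$_2$) holds and $A$ is torsion-free. (III): there is $s\in S$ with $\sigma_s=\kappa\,{\rm id}_A$, $\kappa\in\mathbb Z\setminus\{0,1\}$, $\mathscr B$ has finite rank, and (F) holds for $\tilde\tau$. ($*$): $A=\bigcup_n\mathcal A_n$ for increasing finite rank subgroups, and ((I) and (II)) or (III) holds;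 moreover there is an increasing sequence of finitely generated subgroups $\mathfrak A_k$ with $A=\bigcup_k\mathfrak A_k$ and $\sigma_s(\mathfrak A_k)\subseteq\mathfrak A_k$ for all $s,k$; $S$ and $T$ are right reversible ($Ss\cap St\neq\emptyset$ for all $s,t$, and likewise for $T$); $\mathscr S=S^{-1}S$, $\mathscr A=S^{-1}A=\bigcup_{s\in S}\tilde\sigma_s^{-1}(A)$, $\mathscr T=T^{-1}T$, $\mathscr B=T^{-1}B$; and $\sigma$ satisfies (PC): for every $C\in\mathcal C$ there is $s\in S$ with $\sigma_s(A)\subseteq C$. The symmetrized conditions (I$_s$), ($*_s$) mean that the condition holds for $\sigma$ relative to $\tau$ and also with the roles of $\sigma$ and $\tau$ exchanged. *)

(* Defs.v *)
From Stdlib Require List.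
From HB Require Import structures.
From mathcomp Require Import all_boot all_order all_algebra.
Set Implicit Arguments. Unset Strict Implicit. Unset Printing Implicit Defensive.
Import GRing.Theory.
Local Open Scope ring_scope.

Definition subs {X : Type} (P Q : X -> Prop) := forall x, P x -> Q x.

Definition zsubgroup {X : zmodType} (M : X -> Prop) :=
  M 0 /\ (forall x y, M x -> M y -> M (x - y)).

Definition gsubgroup {G : groupType} (H : G -> Prop) :=
  H 1%g /\ (forall x y, H x -> H y -> H (x * y^-1)%g).

Definition ggen {G : groupType} (P : G -> Prop) (g : G) :=
  forall H : G -> Prop, gsubgroup H -> subs P H -> H g.

Definition zgen {X : zmodType} (P : X -> Prop) (x : X) :=
  forall M : X -> Prop, zsubgroup M -> subs P M -> M x.

Definition torsion_free_on {X : zmodType} (M : X -> Prop) :=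
  forall x m, M x -> (0 < m)%N -> x *+ m = 0 -> x = 0.

Definition zpowg {G : groupType} (a : G) (k : int) : G :=
  match k with Posz n => (a ^+ n)%g | Negz n => ((a ^+ n.+1)^-1)%g end.

Definition finite_order {G : groupType} (a : G) :=
  exists n : nat, (0 < n)%N /\ (a ^+ n)%g = 1%g.

Definition has_order {G : groupType} (a : G) (l : nat) :=
  (0 < l)%N /\ (a ^+ l)%g = 1%g /\
  (forall k : nat, (0 < k)%N -> (k < l)%N -> (a ^+ k)%g <> 1%g).

(* free groups: a subset Bs of G is a free basis of the subgroup it
   generates if no nonempty reduced word over Bs^{+-1} evaluates to 1 *)
Fixpoint eval_word {G : groupType} (w : seq (G * bool)) : G :=
  match w with
  | [::] => 1%g
  | (x, e) :: w' => ((if e then x else x^-1) * eval_word w')%g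
  end.

Fixpoint reduced_word {G : groupType} (w : seq (G * bool)) : Prop :=
  match w with
  | (x, e) :: ((y, f) :: _) as w' => ~ (x = y /\ e = ~~ f) /\ reduced_word w'
  | _ => True
  end.

Definition free_on {G : groupType} (Bs : G -> Prop) :=
  forall w : seq (G * bool), w <> [::] -> reduced_word w ->
    (forall p, List.In p w -> Bs p.1) -> eval_word w <> 1%g.

Definition is_free_subgroup {G : groupType} (H : G -> Prop) :=
  exists Bs : G -> Prop, subs Bs H /\ free_on Bs /\
    (forall g, H g <-> ggen Bs g).

Definition is_abelian_subgroup {G : groupType} (H : G -> Prop) :=
  forall x y, H x -> H y -> (x * y)%g = (y * x)%g.

Definition two_gen_free_or_abelian (G : groupType) :=
  forall a b : G, let H := ggen (fun g => g = a \/ g = b) in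
    is_free_subgroup H \/ is_abelian_subgroup H.

Definition is_gaction (G : groupType) (X : zmodType) (act : G -> X -> X) :=
  (forall g x y, act g (x + y) = act g x + act g y) /\
  (forall x, act 1%g x = x) /\
  (forall g h x, act (g * h)%g x = act g (act h x)).

(* Algebraic actions with globalization.  An algebraic action
   sigma : S -> A together with its globalization
   sigma~ : SS -> AA is encoded by a group G (= SS), a Z-module X (= AA),
   an action act of G on X by automorphisms, a submonoid S of G and a
   subgroup A of X, with sigma_s = act s restricted to A.               *)

Section AlgAction.
Variables (G : groupType) (X : zmodType) (act : G -> X -> X)
          (S : G -> Prop) (A : X -> Prop).

Definition img (s : G) (C : X -> Prop) : X -> Prop :=
  fun x => exists c, C c /\ x = act s c.
Definition preimg (s : G) (C : X -> Prop) : X -> Prop :=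
  fun a => A a /\ C (act s a).

Inductive constructible : (X -> Prop) -> Prop :=
| constr_A : constructible A
| constr_img s C : S s -> constructible C -> constructible (img s C)
| constr_pre s C : S s -> constructible C -> constructible (preimg s C).

Definition is_group_part :=
  forall s, S s -> S (s^-1)%g.

Definition standing_globalized :=
  is_gaction act /\
  S 1%g /\ (forall s t, S s -> S t -> S (s * t)%g) /\ (forall g, ggen S g) /\
  zsubgroup A /\ (forall s a, S s -> A a -> A (act s a)) /\
  (forall x, zgen (fun y => exists g a, A a /\ y = act g a) x) /\
  (forall s t, S s -> S t -> (forall a, A a -> act s a = act t a) -> s = t) /\
  (~ is_group_part ->
     exists s, S s /\ exists a, A a /\ forall b, A b -> act s b <> a) /\
  (forall s, S s -> exists reps : seq X,
      forall a, A a -> exists r, List.In r reps /\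
        exists b, A b /\ a - r = act s b) /\
  (forall C g, constructible C -> (forall c, C c -> act g c = c) -> g = 1%g).

(* A point of Abar = lim_{C in Cc} A/C is a compatible family of cosets:
   p C is a coset a + C (a in A) for C constructible, empty otherwise. *)
Definition point := (X -> Prop) -> (X -> Prop).

Definition coset (a : X) (C : X -> Prop) : X -> Prop := fun x => C (x - a).

Definition in_Abar (p : point) :=
  (forall C, constructible C -> exists a, A a /\ p C = coset a C) /\
  (forall C, ~ constructible C -> p C = (fun _ => False)) /\
  (forall C D, constructible C -> constructible D -> subs D C ->
      subs (p D) (p C)).

Definition iota (a : X) : point := fun C x => constructible C /\ C (x - a).

Definition constr_list (Cs : seq (X -> Prop)) :=
  forall C, List.In C Cs -> constructible C.

Definition agree (Cs : seq (X -> Prop)) (p q : point) :=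
  forall C, List.In C Cs -> p C = q C.

Definition open_Abar (U : point -> Prop) :=
  subs U in_Abar /\
  forall p, U p -> exists Cs, constr_list Cs /\
     forall q, in_Abar q -> agree Cs p q -> U q.

Definition closure_Abar (E : point -> Prop) : point -> Prop :=
  fun p => in_Abar p /\ forall Cs, constr_list Cs -> exists q, E q /\ agree Cs p q.

Definition continuous_on_Abar (D : point -> Prop) (f : point -> point) :=
  forall p, D p -> forall Cs, constr_list Cs -> exists Cs', constr_list Cs' /\
    forall q, D q -> agree Cs' p q -> agree Cs (f q) (f p).

Definition sd_mul (g h : X * G) : X * G := (g.1 + act g.2 h.1, (g.2 * h.2)%g).
Definition sd_one : X * G := (0, 1%g).
Definition sd_inv (g : X * G) : X * G := (- act (g.2^-1)%g g.1, (g.2^-1)%g).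
Definition sd_act (g : X * G) (x : X) : X := g.1 + act g.2 x.
Definition dom_A (g : X * G) (a : X) := A a /\ A (sd_act g a).

(* (dom, theta) is the (unique) extension of the partial action of
   AA x| SS on A to a partial action on Abar by homeomorphisms between
   open sets; the domain of g is the closure of iota(A cap g^{-1}.A). *)
Definition canonical_ext (dom : X * G -> point -> Prop)
           (theta : X * G -> point -> point) :=
  (forall g p, dom g p <-> closure_Abar (fun q => exists a, dom_A g a /\ q = iota a) p) /\
  (forall g, open_Abar (dom g)) /\
  (forall g p, dom g p -> in_Abar (theta g p)) /\
  (forall g, continuous_on_Abar (dom g) (theta g)) /\
  (forall p, in_Abar p -> dom sd_one p /\ theta sd_one p = p) /\
  (forall g p, dom g p -> dom (sd_inv g) (theta g p)) /\
  (forall g h p, dom h p -> dom g (theta h p) ->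
      dom (sd_mul g h) p /\ theta (sd_mul g h) p = theta g (theta h p)) /\
  (forall g a, dom_A g a -> theta g (iota a) = iota (sd_act g a)).

Definition arrow (dom : X * G -> point -> Prop) (e : (X * G) * point) :=
  dom e.1 e.2.
Definition composable (theta : X * G -> point -> point)
           (e f : (X * G) * point) := e.2 = theta f.1 f.2.
Definition arr_mul (e f : (X * G) * point) := (sd_mul e.1 f.1, f.2).

End AlgAction.

(* continuity of a map between arrow spaces of two groupoids
   (the group is discrete, Abar carries the limit topology) *)
Definition arr_continuous
  (G1 : groupType) (X1 : zmodType) (act1 : G1 -> X1 -> X1) S1 A1 dom1
  (G2 : groupType) (X2 : zmodType) (act2 : G2 -> X2 -> X2) S2 A2
  (F : (X1 * G1) * point X1 -> (X2 * G2) * point X2) :=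
  forall e, arrow dom1 e -> forall Cs, constr_list act2 S2 A2 Cs ->
    exists Cs', constr_list act1 S1 A1 Cs' /\
      forall q, arrow dom1 (e.1, q) -> agree Cs' e.2 q ->
        (F (e.1, q)).1 = (F e).1 /\ agree Cs (F (e.1, q)).2 (F e).2.

Definition groupoids_isomorphic
  (G1 : groupType) (X1 : zmodType) (act1 : G1 -> X1 -> X1) S1 A1
  (G2 : groupType) (X2 : zmodType) (act2 : G2 -> X2 -> X2) S2 A2 :=
  exists dom1 theta1 dom2 theta2,
    canonical_ext act1 S1 A1 dom1 theta1 /\ canonical_ext act2 S2 A2 dom2 theta2 /\
  exists (F : (X1 * G1) * point X1 -> (X2 * G2) * point X2)
         (F' : (X2 * G2) * point X2 -> (X1 * G1) * point X1),
    (forall e, arrow dom1 e -> arrow dom2 (F e) /\ F' (F e) = e) /\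
    (forall e, arrow dom2 e -> arrow dom1 (F' e) /\ F (F' e) = e) /\
    (forall e f, arrow dom1 e -> arrow dom1 f ->
       (composable theta1 e f <-> composable theta2 (F e) (F f))) /\
    (forall e f, arrow dom1 e -> arrow dom1 f -> composable theta1 e f ->
       F (arr_mul act1 e f) = arr_mul act2 (F e) (F f)) /\
    arr_continuous act1 S1 A1 dom1 act2 S2 A2 F /\
    arr_continuous act2 S2 A2 dom2 act1 S1 A1 F'.

Definition is_embedding (G1 : groupType) (X1 : zmodType) (r1 : G1 -> X1 -> X1)
  (G2 : groupType) (X2 : zmodType) (r2 : G2 -> X2 -> X2)
  (t : G1 -> G2) (b : X1 -> X2) :=
  (forall g h, t (g * h)%g = (t g * t h)%g) /\ injective t /\
  (forall x y, b (x + y) = b x + b y) /\ injective b /\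
  (forall g x, b (r1 g x) = r2 (t g) (b x)).

Definition emb_full {X1 X2 : zmodType} (b : X1 -> X2) := forall y, exists x, b x = y.
Definition emb_strict {G1 G2 : groupType} (t : G1 -> G2) := forall h, exists g, t g = h.
Definition emb_finite_index {X1 X2 : zmodType} (b : X1 -> X2) :=
  exists reps : seq X2, forall y, exists r, List.In r reps /\ exists x, y - r = b x.

(* Q (x) AA: a Q-vector space V with an injective additive j : X -> V
   such that every v in V has a nonzero multiple in j(X) (for X
   torsion-free this is Q (x) X), and dact the induced action
   id_Q (x) act.                                                       *)
Definition rational_hull (G : groupType) (X : zmodType) (act : G -> X -> X)
  (V : lmodType rat) (j : X -> V) (dact : G -> V -> V) :=
  (forall x y, j (x + y) = j x + j y) /\ injective j /\
  (forall v, exists m, (0 < m)%N /\ exists x, v *+ m = j x) /\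
  (forall g v w, dact g (v + w) = dact g v + dact g w) /\
  (forall g x, dact g (j x) = j (act g x)).

Definition cond_SF (G : groupType) (V : lmodType rat) (dact : G -> V -> V) :=
  forall (s t : G) (rho rho' : V -> V),
    (forall v w, rho (v + w) = rho v + rho w) ->
    (forall v, rho' (rho v) = v) -> (forall v, rho (rho' v) = v) ->
    (forall v, dact s v = rho (dact t (rho' v))) -> s = t.

(* e is a Z-family in M giving a Q-basis of Q (x) M *)
Definition qbasis {X : zmodType} (M : X -> Prop) (d : nat) (e : 'I_d -> X) :=
  (forall i, M (e i)) /\
  (forall k : 'I_d -> int,
     (exists m, (0 < m)%N /\ (\sum_i e i *~ k i) *+ m = 0) -> forall i, k i = 0) /\
  (forall x, M x -> exists m, (0 < m)%N /\
     exists k : 'I_d -> int, x *+ m = \sum_i e i *~ k i).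

Definition finite_rank {X : zmodType} (M : X -> Prop) :=
  exists d e, @qbasis X M d e.

(* p = det(z - id_Q (x) f|_M), for f additive with f(M) in M *)
Definition charpoly_on {X : zmodType} (f : X -> X) (M : X -> Prop)
  (p : {poly rat}) :=
  exists d (e : 'I_d -> X), qbasis M e /\
  exists (N : 'M[int]_d) (m : nat), (0 < m)%N /\
    (forall i, f (e i) *+ m = \sum_j e j *~ N i j) /\
    p = char_poly (map_mx (fun z : int => (z%:~R : rat) / m%:R) N).

Section Conditions.
Variables (G : groupType) (X : zmodType) (act : G -> X -> X)
          (S : G -> Prop) (A : X -> Prop)
          (H : groupType) (Y : zmodType) (actt : H -> Y -> Y)
          (T : H -> Prop) (B : Y -> Prop).

Definition cond_F := forall t : H, t <> 1%g ->
  forall x y : Y, x - actt t x = y - actt t y -> x = y.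

Definition cond_i1 (M : X -> Prop) :=
  (exists s, S s /\ subs (img act s M) M /\
     forall x y, M x -> M y -> x - act s x = y - act s y -> x = y) /\
  two_gen_free_or_abelian H.

Definition scalar_elt (kappa : int) :=
  kappa <> 0 /\ kappa <> 1 /\ exists s, S s /\ forall a, A a -> act s a = a *~ kappa.

Definition cond_i2 :=
  exists kappa : int, scalar_elt kappa /\
    forall alpha : H, (exists beta, zpowg alpha kappa = (alpha ^ beta)%g) ->
      finite_order alpha.

Definition cond_ii1 (M : X -> Prop) :=
  forall l : nat, (1 < l)%N -> (exists alpha : H, has_order alpha l) ->
    exists s, S s /\ s <> 1%g /\ exists mu nu : nat,
      (0 < mu)%N /\ (0 < nu)%N /\ coprime mu nu /\
      subs (img act s M) M /\
      (exists p delta, charpoly_on (act s) M p /\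
         mu%:R *: p = mu%:R *: 'X^delta - (nu%:R)%:P) /\
      ((1 < gcdn l mu)%N \/ (1 < gcdn l nu)%N).

Definition good_seq (Ms : nat -> X -> Prop) :=
  (forall n, zsubgroup (Ms n) /\ finite_rank (Ms n)) /\
  (forall n, subs (Ms n) (Ms n.+1)) /\
  (forall a, A a <-> exists n, Ms n a).

Definition cond_I_seq (Ms : nat -> X -> Prop) :=
  (forall n, cond_i1 (Ms n)) \/ cond_i2.

Definition cond_II_seq (Ms : nat -> X -> Prop) :=
  (forall n, cond_ii1 (Ms n)) \/ (cond_F /\ torsion_free_on A).

Definition cond_I := exists Ms, good_seq Ms /\ cond_I_seq Ms.

Definition cond_III :=
  (exists kappa, scalar_elt kappa) /\ finite_rank (fun _ : Y => True) /\ cond_F.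

Definition right_reversible {K : groupType} (P : K -> Prop) :=
  forall s t, P s -> P t -> exists u v, P u /\ P v /\ (u * s)%g = (v * t)%g.

Definition cond_star :=
  (exists Ms, good_seq Ms /\ ((cond_I_seq Ms /\ cond_II_seq Ms) \/ cond_III)) /\
  (exists Fs : nat -> X -> Prop,
     (forall k, exists gens : seq X, forall x, Fs k x <-> zgen (fun y => List.In y gens) x) /\
     (forall k, subs (Fs k) (Fs k.+1)) /\
     (forall a, A a <-> exists k, Fs k a) /\
     (forall s k, S s -> subs (img act s (Fs k)) (Fs k))) /\
  right_reversible S /\ right_reversible T /\
  (forall g, exists s t, S s /\ S t /\ g = (s^-1 * t)%g) /\
  (forall x, exists s, S s /\ A (act s x)) /\
  (forall h, exists s t, T s /\ T t /\ h = (s^-1 * t)%g) /\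
  (forall y, exists t, T t /\ B (actt t y)) /\
  (forall C, constructible act S A C -> exists s, S s /\ forall a, A a -> C (act s a)).

End Conditions.

(* Main.v *)
(* A groupoid isomorphism restricts to a cocycle c(g, a) with values in
   BB x| TT, defined for a in A and g.a in A, which is locally constant in a.
   By compactness of Abar, each c(m, .) with m in A depends only on the class
   modulo some constructible subgroup C, so m |-> c(m, 0) is an injective
   homomorphism on the elements m of C admitting C as a period, and conjugation
   by s in SS corresponds to conjugation by c(s, 0).  Conditions (I) and (III)
   force the TT-component of c(N a, 0) to vanish for suitable N > 0: either
   because an element alpha of a free group commuting with beta alpha beta^-1
   commutes with beta, or because an eigenvalue argument shows that alpha has
   finite order.  Then a |-> c(N a, 0) / N is an equivariant embedding of
   Q (x) AA into Q (x) BB along the TT-component of g |-> c(g, 0).  Under ( * )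
   one may replace the multiple N a by sigma_s(a) with s in S deep enough, which
   makes the embedding integral.  In finite rank, mutually embedded spaces have
   equal dimension, and an injective endomorphism of a torsion-free group of
   finite rank has image of finite index by Cayley-Hamilton. *)

From HB Require Import structures.
From mathcomp Require Import all_boot all_order all_algebra all_field.
From mathcomp Require Import ring zify.
From mathcomp Require Import boolp classical_sets filter.
Require Import Defs.
Set Implicit Arguments. Unset Strict Implicit. Unset Printing Implicit Defensive.
Import Order.TTheory GRing.Theory Num.Theory.
Local Open Scope ring_scope.

(** * Constructible subgroups and the cocycle of a groupoid isomorphism *)

(** The obstacle is that the subgroup C on which c(m, .) is constant depends on m: the map m |->
    c(m, 0) need not be additive on A, and only finitely many elements, or a finitely generated
    subgroup, can be given a common C. The embedding is therefore built element by element from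
    values at sufficiently divisible multiples; finite index of C brings multiples of any a into C,
    and each identity is checked at a common multiple. There the invariant finitely generated
    subgroups in [cond_star] matter: such a subgroup contains sigma_s(a) for all s at once, so one C
    serves every s before (PC) selects an s that is deep enough. *)

Lemma pred_ext (T : Type) (P Q : T -> Prop) : (forall x, P x <-> Q x) -> P = Q.
Proof. by move=> PQ; apply/funext => x; apply/propext. Qed.

Lemma list_pigeonhole (T : Type) (P : nat -> T -> Prop) (reps : seq T) :
  (forall i, exists r, List.In r reps /\ P i r) ->
  exists i j r, (i < j)%N /\ P i r /\ P j r.
Proof.
move=> cov.
have /choice[f fP] : forall i, exists n,
    (n < size reps)%N /\ exists r, List.nth_error reps n = Some r /\ P i r.
  move=> i; have [r [/(List.In_nth_error reps) [n nr] Pir]] := cov i.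
  exists n; split; last by exists r.
  by apply/ssrnat.ltP; apply/List.nth_error_Some; rewrite nr.
pose g (i : 'I_(size reps).+1) : 'I_(size reps) := Ordinal (fP i).1.
have : ~~ injectiveb g.
  by apply/negP => /injectiveP /leq_card; rewrite !card_ord ltnn.
case/injectivePn => i [j ij gij].
have fij : f i = f j by move/(congr1 val): gij.
have [_ [r [nr Pir]]] := fP i; have [_ [r' [nr' Pjr]]] := fP j.
have rr' : r = r' by move: nr'; rewrite -fij nr => -[].
subst r'; case: (ltngtP i j) ij => [lt|lt|/val_inj ->]; last by rewrite eqxx.
  by move=> _; exists i, j, r.
by move=> _; exists j, i, r.
Qed.

Section Subgroups.
Variables (X : zmodType) (M : X -> Prop).
Hypothesis sM : zsubgroup M.

Lemma zsub0 : M 0. Proof. by case: sM. Qed.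
Lemma zsubB x y : M x -> M y -> M (x - y). Proof. by case: sM => _; apply. Qed.
Lemma zsubN x : M x -> M (- x).
Proof. by move=> Mx; rewrite -[- x]add0r; apply: zsubB => //; exact: zsub0. Qed.
Lemma zsubD x y : M x -> M y -> M (x + y).
Proof. by move=> Mx My; rewrite -[y]opprK; apply: zsubB => //; exact: zsubN. Qed.
Lemma zsubMn x n : M x -> M (x *+ n).
Proof.
move=> Mx; elim: n => [|n IHn]; first by rewrite mulr0n; exact: zsub0.
by rewrite mulrS; exact: zsubD.
Qed.
Lemma zsubMz x (z : int) : M x -> M (x *~ z).
Proof.
by case: z => n Mx; rewrite ?NegzE ?mulrNz; [|apply: zsubN]; exact: zsubMn.
Qed.
Lemma zsub_sum (I : Type) (r : seq I) (P : pred I) (E : I -> X) :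
  (forall i, P i -> M (E i)) -> M (\sum_(i <- r | P i) E i).
Proof. by move=> ME; elim/big_rec: _ => [|i x /ME ? ?]; [exact: zsub0|exact: zsubD]. Qed.
End Subgroups.

Lemma zgen_min (X : zmodType) (P M : X -> Prop) :
  zsubgroup M -> subs P M -> subs (zgen P) M.
Proof. by move=> sM PM x; apply. Qed.

Lemma zgen_zsubgroup (X : zmodType) (P : X -> Prop) : zsubgroup (zgen P).
Proof.
split=> [M sM _|x y Px Py M sM PM]; first exact: zsub0.
by apply: zsubB => //; [exact: Px|exact: Py].
Qed.

Lemma ggen_min (G : groupType) (P K : G -> Prop) :
  gsubgroup K -> subs P K -> subs (ggen P) K.
Proof. by move=> sK PK x; apply. Qed.

Section AdditiveActions.
Variables (G : groupType) (X : zmodType) (act : G -> X -> X).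
Hypothesis aact : is_gaction act.

Lemma actD g x y : act g (x + y) = act g x + act g y. Proof. by case: aact. Qed.
Lemma act1 x : act 1%g x = x. Proof. by case: aact => _ []. Qed.
Lemma actM g h x : act (g * h)%g x = act g (act h x). Proof. by case: aact => _ []. Qed.
Lemma act0 g : act g 0 = 0. Proof. by apply: (addrI (act g 0)); rewrite -actD !addr0. Qed.
Lemma actN g x : act g (- x) = - act g x.
Proof. by apply: (addrI (act g x)); rewrite -actD !subrr act0. Qed.
Lemma actB g x y : act g (x - y) = act g x - act g y. Proof. by rewrite actD actN. Qed.
Lemma actMn g x n : act g (x *+ n) = act g x *+ n.
Proof. by elim: n => [|n IHn]; rewrite ?mulr0n ?act0 // !mulrS actD IHn. Qed.
Lemma actK g x : act g^-1%g (act g x) = x. Proof. by rewrite -actM mulVg act1. Qed.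
Lemma actVK g x : act g (act g^-1%g x) = x. Proof. by rewrite -actM mulgV act1. Qed.
Lemma act_inj g : injective (act g). Proof. exact: can_inj (actK g). Qed.
End AdditiveActions.

Section Standing.
Variables (G : groupType) (X : zmodType) (act : G -> X -> X).
Variables (S : G -> Prop) (A : X -> Prop).
Hypothesis st : standing_globalized act S A.

Lemma st_act : is_gaction act. Proof. by case: st. Qed.
Lemma st_S1 : S 1%g. Proof. by case: st => _ []. Qed.
Lemma st_SM s t : S s -> S t -> S (s * t)%g.
Proof. by case: st => _ [_ [h _]]; apply: h. Qed.
Lemma st_SX s n : S s -> S (s ^+ n)%g.
Proof.
move=> Ss; elim: n => [|n IHn]; first by rewrite expg0; exact: st_S1.
by rewrite expgS; exact: st_SM.
Qed.
Lemma st_gen g : ggen S g. Proof. by case: st => _ [_ [_ [h _]]]; apply: h. Qed.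
Lemma st_A : zsubgroup A. Proof. by case: st => _ [_ [_ [_ [h _]]]]. Qed.
Lemma st_actA s a : S s -> A a -> A (act s a).
Proof. by case: st => _ [_ [_ [_ [_ [h _]]]]]; apply: h. Qed.
Lemma st_zgen x : zgen (fun y => exists g a, A a /\ y = act g a) x.
Proof. by case: st => _ [_ [_ [_ [_ [_ [h _]]]]]]; apply: h. Qed.
Lemma st_faithful s t : S s -> S t -> (forall a, A a -> act s a = act t a) -> s = t.
Proof. by case: st => _ [_ [_ [_ [_ [_ [_ [h _]]]]]]]; apply: h. Qed.
Lemma st_FI s : S s -> exists reps : seq X, forall a, A a ->
  exists r, List.In r reps /\ exists b, A b /\ a - r = act s b.
Proof. by case: st => _ [_ [_ [_ [_ [_ [_ [_ [_ [h _]]]]]]]]]; apply: h. Qed.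
Lemma st_JF g : (forall a, A a -> act g a = a) -> g = 1%g.
Proof.
case: st => _ [_ [_ [_ [_ [_ [_ [_ [_ [_ h]]]]]]]]] fixA.
by apply: (h A) => //; exact: constr_A.
Qed.

Notation constr := (constructible act S A).

Lemma constr_sub C : constr C -> subs C A.
Proof.
elim=> [|s D Ss _ IH|s D Ss _ IH] x //; last by case.
by case=> c [/IH Ac ->]; exact: st_actA.
Qed.

Lemma constr_zsub C : constr C -> zsubgroup C.
Proof.
have aact := st_act; have sA := st_A.
elim=> [//|s D Ss _ IH|s D Ss _ IH]; split.
- by exists 0; rewrite (act0 aact); split => //; exact: zsub0.
- move=> _ _ [x [Dx ->]] [y [Dy ->]]; exists (x - y).
  by rewrite (actB aact); split => //; exact: zsubB.
- by split; [exact: zsub0|rewrite (act0 aact); exact: zsub0].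
- move=> x y [Ax Dx] [Ay Dy]; split; first exact: zsubB.
  by rewrite (actB aact); exact: zsubB.
Qed.

(** Directedness of the family. The meet is moved inside the outermost operation: sigma_s(E) meets D
    in sigma_s(E meet sigma_s^-1 D), and sigma_s^-1(E) meets D in sigma_s^-1(E meet sigma_s D), the
    latter by injectivity. *)
Lemma constrI C D : constr C -> constr D -> constr (fun x => C x /\ D x).
Proof.
have aact := st_act => cC; elim: cC D => [|s E Ss cE IH|s E Ss cE IH] D cD.
- rewrite (_ : (fun x => _) = D) //; apply: pred_ext => x; split=> [[]//|Dx].
  by split => //; exact: (constr_sub cD).
- rewrite (_ : (fun x => _) = img act s (fun x => E x /\ preimg act A s D x)).
    by apply: constr_img => //; apply: IH; exact: constr_pre.
  apply: pred_ext => x; split=> [[[c [Ec ->]] Dx]|[c [[Ec [Ac Dc]] ->]]].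
    by exists c; split => //; split => //; split => //; exact: (constr_sub cE).
  by split => //; exists c.
- rewrite (_ : (fun x => _) = preimg act A s (fun x => E x /\ img act s D x)).
    by apply: constr_pre => //; apply: IH; exact: constr_img.
  apply: pred_ext => x; split=> [[[Ax Ex] Dx]|[Ax [Ex [c [Dc]]]]].
    by split => //; split => //; exists x.
  by move/(act_inj aact) => xc; subst x.
Qed.

Lemma constr_list_meet Cs : constr_list act S A Cs ->
  exists C, constr C /\ forall x, C x -> forall D, List.In D Cs -> D x.
Proof.
elim: Cs => [|D Cs IH] cCs; first by exists A; split=> //; exact: constr_A.
have [|C [cC CP]] := IH; first by move=> E inE; apply: cCs; right.
exists (fun x => C x /\ D x); split.
  by apply: constrI => //; apply: cCs; left.
by move=> x [Cx Dx] E [<-//|]; exact: CP.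
Qed.

Lemma constr_index C : constr C -> exists reps : seq X, forall a, A a ->
  exists r, List.In r reps /\ C (a - r).
Proof.
have aact := st_act; have sA := st_A.
elim=> [|s D Ss cD [reps repsP]|s D Ss cD [reps repsP]].
- by exists [:: 0] => a Aa; exists 0; rewrite subr0; split => //; left.
- have [rs rsP] := st_FI Ss.
  exists (List.flat_map (fun r => List.map (fun r' => r + act s r') reps) rs) => a Aa.
  have [r [inr [b [Ab ab]]]] := rsP _ Aa; have [r' [inr' Dbr]] := repsP _ Ab.
  exists (r + act s r'); split.
    by apply/List.in_flat_map; exists r; split => //; apply/List.in_map_iff; exists r'.
  by exists (b - r'); rewrite (actB aact) -ab opprD addrA.
- have sD := constr_zsub cD.
  (* The representatives of D need not lie in sigma_s(A); for each coset r + D that meets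
     sigma_s(A), some a' in A mapped into it is chosen instead. *)
  have [rs rsP] : exists rs : seq X, forall r a, List.In r reps -> A a ->
      D (act s a - r) -> exists a', [/\ List.In a' rs, A a' & D (act s a' - r)].
    elim: reps {repsP} => [|r0 reps [rs rsP]]; first by exists [::].
    have [[a0 [Aa0 Da0]]|no] := pselect (exists a, A a /\ D (act s a - r0)).
      exists (a0 :: rs) => r a [<- Aa Da|inr Aa Da].
        by exists a0; split => //; left.
      by have [a' [? ? ?]] := rsP _ _ inr Aa Da; exists a'; split => //; right.
    exists rs => r a [<- Aa Da|]; last exact: rsP.
    by case: no; exists a.
  exists rs => a Aa; have [r [inr Dar]] := repsP _ (st_actA Ss Aa).
  have [a' [ina' Aa' Da']] := rsP _ _ inr Aa Dar.
  exists a'; split => //; split; first exact: zsubB.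
  by have := zsubB sD Dar Da'; rewrite (actB aact) opprB addrA subrK.
Qed.

Lemma constr_mult C a : constr C -> A a -> exists N, (0 < N)%N /\ C (a *+ N).
Proof.
move=> cC Aa; have sC := constr_zsub cC; have [reps repsP] := constr_index cC.
have [|i [j [r [ij [Ci Cj]]]]] :=
    @list_pigeonhole _ (fun i r => C (a *+ i - r)) reps.
  by move=> i; apply: repsP; apply: zsubMn => //; exact: st_A.
exists (j - i)%N; rewrite subn_gt0; split=> //.
have := zsubB sC Cj Ci; rewrite opprB addrA subrK.
by rewrite mulrnBr // ltnW.
Qed.

(* By (FI) every translate of A is commensurable with A. *)
Lemma st_sat x : exists N, (0 < N)%N /\ A (x *+ N).
Proof.
have aact := st_act; have sA := st_A.
pose sat x := exists N, (0 < N)%N /\ A (x *+ N).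
have s_sat : zsubgroup sat.
  split; first by exists 1%N; split => //; exact: zsub0.
  move=> u v [N [N0 AN]] [N' [N0' AN']]; exists (N * N')%N; rewrite muln_gt0 N0.
  split => //; rewrite mulrnBl; apply: zsubB => //; last rewrite mulnC.
    by rewrite mulrnA; exact: zsubMn.
  by rewrite mulrnA; exact: zsubMn.
suff sat_act : forall g, (forall u, sat u -> sat (act g u)) /\
    (forall u, sat u -> sat (act g^-1%g u)).
  apply: (zgen_min s_sat _ (@st_zgen x)) => _ [g [a [Aa ->]]].
  by apply: (sat_act g).1; exists 1%N.
pose K g := (forall u, sat u -> sat (act g u)) /\ (forall u, sat u -> sat (act g^-1%g u)).
move=> g; apply: (@ggen_min _ S K _ _ g (st_gen g)).
  split; first by rewrite /K invg1; split=> u su; rewrite act1.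
  move=> h h' [h1 h2] [h1' h2']; rewrite /K invgM invgK.
  by split=> u su; rewrite actM //; [apply/h1/h2'|apply/h1'/h2].
move=> s Ss; split=> u [N [N0 AN]].
  by exists N; split => //; rewrite -actMn //; exact: st_actA.
(* For sigma_s^-1, a further multiple lands in sigma_s(A), which is constructible and so of finite
   index. *)
have [N' [N0' [b [Ab bE]]]] := constr_mult (constr_img Ss (constr_A act S A)) AN.
exists (N * N')%N; rewrite muln_gt0 N0; split => //.
by rewrite mulrnA -!actMn // bE actK.
Qed.

End Standing.

(* The data carried by a groupoid isomorphism once restricted to A: the group
   coordinate [c g a] of the image of the arrow [(g, a)].  The last clause is
   where the compactness of Abar enters. *)
Definition is_cocycle (G : groupType) (X : zmodType) (act : G -> X -> X)
    (S : G -> Prop) (A : X -> Prop) (H : groupType) (Y : zmodType)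
    (actt : H -> Y -> Y) (c : X * G -> X -> Y * H) :=
  [/\ forall g h a, dom_A act A h a -> dom_A act A g (sd_act act h a) ->
        c (sd_mul act g h) a = sd_mul actt (c g (sd_act act h a)) (c h a),
      forall g, dom_A act A g 0 -> c g 0 = sd_one H Y -> g = sd_one G X,
      forall g a, dom_A act A g a -> exists C, constructible act S A C /\
        forall a', dom_A act A g a' -> C (a' - a) -> c g a' = c g a
    & forall m, A m -> exists C, constructible act S A C /\
        forall x y, A x -> A y -> C (x - y) -> c (m, 1%g) x = c (m, 1%g) y].

(** * Points of the completion and ultralimits *)

Section Points.
Variables (G : groupType) (X : zmodType) (act : G -> X -> X).
Variables (S : G -> Prop) (A : X -> Prop).
Hypothesis st : standing_globalized act S A.
Notation constr := (constructible act S A).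
Notation iota := (iota act S A).

Lemma iota_constr a C : constr C -> iota a C = coset a C.
Proof. by move=> cC; apply: pred_ext => x; split => [[]|]. Qed.

Lemma coset_eq a b C : constr C -> C (a - b) -> coset a C = coset b C.
Proof.
move=> cC Cab; have sC := constr_zsub st cC; apply: pred_ext => x; rewrite /coset.
by split=> [/(zsubD sC)/(_ Cab)|/(zsubB sC)/(_ Cab)]; rewrite ?opprB addrA subrK.
Qed.

Lemma iota_in_Abar a : A a -> in_Abar act S A (iota a).
Proof.
move=> Aa; split; last split.
- by move=> C cC; exists a; rewrite iota_constr.
- by move=> C ncC; apply: pred_ext => x; split=> // -[].
- by move=> C D cC cD DC x [_ Dx]; split => //; exact: DC.
Qed.

Lemma iota_agree a b Cs : constr_list act S A Cs ->
  (forall C, List.In C Cs -> C (a - b)) -> agree Cs (iota a) (iota b).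
Proof.
move=> cCs Cab C inC; have cC := cCs C inC.
by rewrite !iota_constr //; apply: coset_eq => //; exact: Cab.
Qed.

(* Compactness of Abar, in the form needed here: along an ultrafilter refining
   the directed family of constructible subgroups every net in A converges. *)
Lemma ultralimit (x : (X -> Prop) -> X) (F : set_system (X -> Prop)) :
  UltraFilter F -> (forall C, constr C -> F (fun D => constr D /\ subs D C)) ->
  (forall D, constr D -> A (x D)) ->
  exists p, in_Abar act S A p /\ forall C, constr C -> F (fun D => p C = iota (x D) C).
Proof.
move=> FU Fcone Ax.
pose p C z := constr C /\ F (fun D => C (z - x D)).
have pP C : constr C -> exists a, [/\ A a, p C = coset a C & F (fun D => C (x D - a))].
  move=> cC; have sC := constr_zsub st cC; have [reps repsP] := constr_index st cC.
  have [a [Aa FaC]] : exists a, A a /\ F (fun D => C (x D - a)).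
    have [r Fr] : exists r, F (fun D => C (x D - r)).
      have : F (fun D => exists r, List.In r reps /\ C (x D - r)).
        apply: filterS (Fcone _ cC) => D [cD _]; exact/repsP/Ax.
      (* Finitely many cosets of C cover A, so the ultrafilter concentrates on one of them; cosets
         that are not large are discarded one by one. *)
      elim: reps {repsP} => [|r reps IH] Fr.
        by have [D [r []]] := filter_ex Fr.
      have [?|Fn] := in_ultra_setVsetC (fun D => C (x D - r)) FU; first by exists r.
      apply: IH; apply: filterS (filterI Fr Fn) => D [[r' [[<-//|inr'] Cr']] _].
      by exists r'.
    have [D [[cD _] CD]] := filter_ex (filterI (Fcone _ cC) Fr).
    exists (x D); split; first exact: Ax.
    apply: filterS Fr => E CE.
    by have := zsubB sC CE CD; rewrite opprB addrA subrK.
  exists a; split => //; apply: pred_ext => z; split=> [[_ Fz]|Cz].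
    have [D [CzD CDa]] := filter_ex (filterI Fz FaC).
    by rewrite /coset; have := zsubD sC CzD CDa; rewrite addrA subrK.
  split=> //; apply: filterS FaC => D CDa.
  by have := zsubB sC Cz CDa; rewrite opprB addrA subrK.
exists p; split.
  split; last split.
  - by move=> C /pP [a [Aa -> _]]; exists a.
  - by move=> C ncC; apply: pred_ext => z; split => // -[].
  - move=> C D cC cD DC z [_ Fz]; split=> //.
    by apply: filterS Fz => E; exact: DC.
move=> C cC; have [a [Aa -> FaC]] := pP C cC.
apply: filterS FaC => D CDa /=; rewrite iota_constr //; symmetry.
exact: coset_eq.
Qed.

End Points.

Lemma cone_ultrafilter (G : groupType) (X : zmodType) (act : G -> X -> X)
    (S : G -> Prop) (A : X -> Prop) : standing_globalized act S A ->
  exists F : set_system (X -> Prop), UltraFilter F /\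
    forall C, constructible act S A C ->
      F (fun D => constructible act S A D /\ subs D C).
Proof.
move=> st; pose F0 : set_system (X -> Prop) := fun U =>
  exists C, constructible act S A C /\
    forall D, constructible act S A D -> subs D C -> U D.
have PF0 : ProperFilter F0.
  split; first by case=> C [cC /(_ C cC)]; apply.
  split.
  - by exists A; split=> //; exact: constr_A.
  - move=> U U' [C [cC CU]] [C' [cC' CU']].
    exists (fun x => C x /\ C' x); split; first exact: constrI st _ _ _ _.
    by move=> D cD DC; split; [apply: CU|apply: CU'] => // x /DC [].
  - by move=> U U' UU' [C [cC CU]]; exists C; split => // D cD DC; exact/UU'/CU.
have [F [FU F0F]] := ultraFilterLemma PF0.
by exists F; split => // C cC; apply: F0F; exists C.
Qed.

Section IsoCocycle.
Variables (G : groupType) (X : zmodType) (act : G -> X -> X).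
Variables (S : G -> Prop) (A : X -> Prop).
Variables (H : groupType) (Y : zmodType) (actt : H -> Y -> Y).
Variables (T : H -> Prop) (B : Y -> Prop).
Hypotheses (st : standing_globalized act S A) (stt : standing_globalized actt T B).

Lemma groupoids_isomorphic_sym :
  groupoids_isomorphic act S A actt T B -> groupoids_isomorphic actt T B act S A.
Proof.
case=> d1 [th1 [d2 [th2 [e1 [e2 [F [F' [FP [F'P [comp [mul [cF cF']]]]]]]]]]]].
exists d2, th2, d1, th1; do 2!split => //; exists F', F; do 2!split => //.
split; [|split => //].
  move=> e f de df; have [d1e Fe] := F'P e de; have [d1f Ff] := F'P f df.
  by have := comp _ _ d1e d1f; rewrite Fe Ff; tauto.
move=> e f de df ef; have [d1e Fe] := F'P e de; have [d1f Ff] := F'P f df.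
have ef1 : composable th1 (F' e) (F' f) by apply/comp => //; rewrite Fe Ff.
rewrite -{1}Fe -{1}Ff -mul //; apply: (FP _ _).2.
case: e1 => _ [_ [_ [_ [_ [_ [mulc _]]]]]].
by apply: (mulc _ _ _ d1f _).1; rewrite -ef1.
Qed.

Lemma iso_cocycle : groupoids_isomorphic act S A actt T B ->
  exists c, is_cocycle act S A actt c.
Proof.
case=> d1 [th1 [d2 [th2 [e1 [e2 [F [F' [FP [F'P [comp [mul [cF cF']]]]]]]]]]]].
case: (e1) => dE [_ [_ [_ [one1 [_ [mulc1 thA]]]]]].
case: (e2) => dE2 [_ [_ [_ [one2 _]]]].
have dA g a : dom_A act A g a -> d1 g (iota act S A a).
  move=> da; apply/dE; split; first by apply: iota_in_Abar; case: da.
  by move=> Cs _; exists (iota act S A a); split=> //; exists a.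
have in2 g p : d2 g p -> in_Abar actt T B p by move/dE2 => [].
have in1 g p : d1 g p -> in_Abar act S A p by move/dE => [].
exists (fun g a => (F (g, iota act S A a)).1); split.
- move=> g h a dh dg.
  have := mul (g, iota act S A (sd_act act h a)) (h, iota act S A a)
    (dA _ _ dg) (dA _ _ dh).
  by rewrite /composable /= thA // => /(_ erefl) -> /=.
(* The unit arrow at 0 has an image with trivial group coordinate, by cancellation. The arrow g
   composes with it, so both images have the same source; if they also share the group coordinate
   they coincide, and injectivity of [F] gives g = 1. *)
- move=> g dg gE; have dg1 := dA _ _ dg; have [/one1 [d10 th10]] := (in1 _ _ dg1, tt).
  set o := iota act S A 0 in gE dg1 d10 th10 *.
  have cgo : composable th1 (g, o) (sd_one G X, o) by rewrite /composable /= th10.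
  have coo : composable th1 (sd_one G X, o) (sd_one G X, o) by rewrite /composable /= th10.
  have [d2o Fo] := FP (sd_one G X, o) d10.
  have Fo1 : (F (sd_one G X, o)).1 = sd_one H Y.
    have := congr1 fst (mul _ _ (d10 : arrow d1 (_, _)) (d10 : arrow d1 (_, _)) coo).
    rewrite /arr_mul /= /sd_mul /= act0 ?addr0 ?mulg1; last exact: st_act st.
    case: (F _).1 => y h /= [] /esym yE /esym hE; have h1 : h = 1%g.
      by apply: (mulgI h); rewrite mulg1.
    have y0 : y = 0 by move: yE; rewrite h1 (act1 (st_act stt)) -[RHS]addr0 => /addrI.
    by rewrite h1 y0.
  have F2 : (F (g, o)).2 = (F (sd_one G X, o)).2.
    have := (comp (g, o) (sd_one G X, o) dg1 d10).1 cgo; rewrite /composable => ->.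
    rewrite Fo1; apply: (one2 _ _).2.
    by apply: in2 (d2o : d2 _ _).
  have : F (g, o) = F (sd_one G X, o).
    by rewrite [LHS]surjective_pairing [RHS]surjective_pairing F2 Fo1 gE.
  by move/(congr1 F'); rewrite Fo (FP (g, o) dg1).2 => -[].
(* With the empty list of target constraints, continuity speaks only of the group coordinate, which
   is discrete. *)
- move=> g a da; have [Cs [cCs CsP]] := cF (g, iota act S A a) (dA _ _ da) [::]
    (fun _ => False_ind _).
  have [C [cC CP]] := constr_list_meet st cCs; exists C; split => // a' da' Ca'.
  apply: (CsP _ (dA _ _ da') _).1 => /=.
  by apply: (iota_agree st) => // D inD; rewrite -opprB;
    apply: (zsubN (constr_zsub st (cCs D inD))); apply: CP.
(* If no C is a period, choose for each C a pair in one coset of C with different values. The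
   ultralimit p of the first entries is also that of the second entries, and local constancy at (m,
   p) makes some pair have equal values. *)
move=> m Am; apply: contrapT => no.
have bad C : constructible act S A C -> exists xy : X * X, [/\ A xy.1, A xy.2, C (xy.1 - xy.2) &
    (F ((m, 1%g), iota act S A xy.1)).1 <> (F ((m, 1%g), iota act S A xy.2)).1].
  move=> cC; apply: contrapT => noxy; apply: no; exists C; split => // x y Ax Ay Cxy.
  by apply: contrapT => ne; apply: noxy; exists (x, y).
have /choice[xy xyP] C : exists xy : X * X, constructible act S A C ->
    [/\ A xy.1, A xy.2, C (xy.1 - xy.2) &
    (F ((m, 1%g), iota act S A xy.1)).1 <> (F ((m, 1%g), iota act S A xy.2)).1].
  by have [/bad [u uP]|nC] := pselect (constructible act S A C); [exists u|exists (0, 0)].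
have [U [UU Ucone]] := cone_ultrafilter st.
have [|p [ip pP]] := ultralimit st (x := fun C => (xy C).1) UU Ucone.
  by move=> D /xyP [].
have agreeU Cs : constr_list act S A Cs ->
    U (fun D => constructible act S A D /\ agree Cs p (iota act S A (xy D).1) /\
               agree Cs p (iota act S A (xy D).2)).
  move=> cCs; have [C [cC CP]] := constr_list_meet st cCs.
  have : U (fun D => agree Cs p (iota act S A (xy D).1)).
    elim: Cs cCs {CP} => [|E Cs IH] cCs; first by apply: filterE => D C' [].
    have UE := pP E (cCs E (or_introl erefl)).
    have UCs := IH (fun C' inC' => cCs C' (or_intror inC')).
    by apply: filterS (filterI UE UCs) => D [pE pCs] C' [<-//|]; exact: pCs.
  move=> UCs; apply: filterS (filterI (Ucone _ cC) UCs) => D [[cD DC] pD].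
  have [_ _ Dxy _] := xyP D cD; do 2!split => //.
  have ag := @iota_agree _ _ _ _ _ st _ _ _ cCs (fun C' inC' => CP _ (DC _ Dxy) C' inC').
  by move=> C' inC'; rewrite -(ag C' inC'); apply: pD.
have dm a : A a -> dom_A act A (m, 1%g) a.
  move=> Aa; split => //; rewrite /sd_act /= (act1 (st_act st)).
  exact: (zsubD (st_A st)).
have dp : d1 (m, 1%g) p.
  apply/dE; split => // Cs /agreeU /filter_ex [D [cD [pD _]]].
  have [Ax _ _ _] := xyP D cD.
  by exists (iota act S A (xy D).1); split => //; exists (xy D).1; split => //; exact: dm.
have [Cs [cCs CsP]] := cF (((m, 1%g) : X * G), p) dp [::] (fun _ => False_ind _).
have [D [cD [p1 p2]]] := filter_ex (agreeU _ cCs).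
have [Ax Ay _] := xyP D cD; apply.
by rewrite (CsP _ (dA _ _ (dm _ Ax)) p1).1 (CsP _ (dA _ _ (dm _ Ay)) p2).1.
Qed.

End IsoCocycle.

(** * Commuting conjugates in free groups *)

Lemma eval_word_cat (G : groupType) (w w' : seq (G * bool)) :
  eval_word (w ++ w') = (eval_word w * eval_word w')%g.
Proof. by elim: w => [|[x e] w IH] /=; rewrite ?mul1g // IH mulgA. Qed.

Lemma not_reduced_word (G : groupType) (w : seq (G * bool)) : ~ reduced_word w ->
  exists w1 x e w2, w = w1 ++ (x, e) :: (x, ~~ e) :: w2.
Proof.
elim: w => [|[x e] [|[y f] w] IH] nred; try by case: nred.
have [[-> ef]|nxy] := pselect (x = y /\ e = ~~ f).
  by exists [::], y, (~~ f), w; rewrite ef negbK.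
have [|w1 [z [e' [w2 ->]]]] := IH; first by move=> red; apply: nred.
by exists ((x, e) :: w1), z, e', w2.
Qed.

Section FreeHom.
Variables (G K : groupType) (Bs : G -> Prop) (phi : G -> K).
Hypothesis freeBs : free_on Bs.

Definition map_word (w : seq (G * bool)) : seq (K * bool) := [seq (phi p.1, p.2) | p <- w].
Definition word_over (w : seq (G * bool)) := forall p, List.In p w -> Bs p.1.

Lemma word_over_cat w w' : word_over w -> word_over w' -> word_over (w ++ w').
Proof. by move=> ow ow' p /(List.in_app_or w w') [?|?]; [exact: ow|exact: ow']. Qed.

(** Well-definedness of the extension of [phi]: by freeness a nonempty trivial word contains a
    cancelling pair, and deleting the pair changes the value neither before nor after applying
    [phi]. *)
Lemma free_word_trivial w : word_over w -> eval_word w = 1%g ->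
  eval_word (map_word w) = 1%g.
Proof.
have [n] := ubnP (size w); elim: n w => // n IHn w; rewrite ltnS => lw ow ew.
have [->//|w0] := pselect (w = [::]).
have [red|/not_reduced_word [w1 [x [e [w2 wE]]]]] := pselect (reduced_word w).
  by case: (freeBs w0 red ow ew).
have red1 (L : groupType) (u : L) : ((if e then u else u^-1) * (if ~~ e then u else u^-1) = 1)%g.
  by case: (e); rewrite ?mulgV ?mulVg.
move: ew; rewrite wE eval_word_cat /= [X in (_ * X)%g]mulgA red1 mul1g -eval_word_cat => ew.
rewrite /map_word map_cat eval_word_cat /= [X in (_ * X)%g]mulgA red1 mul1g.
rewrite -eval_word_cat -map_cat; apply: IHn => //.
  by apply: leq_trans lw; rewrite wE !size_cat /= ltn_add2l.
move=> p /(List.in_app_or w1 w2) inp; apply: ow; rewrite wE; apply: (List.in_or_app w1).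
by case: inp => inp; [left|right; right; right].
Qed.

Lemma word_inv w : word_over w -> exists w', [/\ word_over w',
  eval_word w' = (eval_word w)^-1%g & eval_word (map_word w') = (eval_word (map_word w))^-1%g].
Proof.
elim: w => [|[x e] w IH] ow; first by exists [::]; rewrite /= !invg1; split.
have [|w' [ow' e1 e2]] := IH; first by move=> p inp; apply: ow; right.
exists (w' ++ [:: (x, ~~ e)]); rewrite /map_word map_cat !eval_word_cat /=.
rewrite !mulg1 e1 -/(map_word w').
rewrite e2 !invgM; split; [|by case: (e); rewrite ?invgK|by case: (e); rewrite ?invgK].
apply: word_over_cat => // p [<-|//].
by apply: (ow (x, e)); left.
Qed.

(* The graph of the homomorphism extending [phi] on the free basis [Bs]. *)
Definition free_hom g kap :=
  exists w, [/\ word_over w, eval_word w = g & eval_word (map_word w) = kap].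

Lemma free_hom1 : free_hom 1%g 1%g. Proof. by exists [::]; split=> // p. Qed.

Lemma free_homM g h a b : free_hom g a -> free_hom h b -> free_hom (g * h)%g (a * b)%g.
Proof.
move=> [w [ow <- <-]] [w' [ow' <- <-]]; exists (w ++ w').
by rewrite /map_word map_cat !eval_word_cat; split => //; exact: word_over_cat.
Qed.

Lemma free_homV g a : free_hom g a -> free_hom g^-1%g a^-1%g.
Proof. by move=> [w [/word_inv [w' [ow' e1 e2]] <- <-]]; exists w'. Qed.

Lemma free_hom_basis x : Bs x -> free_hom x (phi x).
Proof. by move=> Bx; exists [:: (x, true)]; rewrite /= !mulg1; split => // p [<-|//]. Qed.

Lemma free_hom_unique g a b : free_hom g a -> free_hom g b -> a = b.
Proof.
move=> ga /free_homV gb; have [w [ow]] := free_homM ga gb.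
rewrite mulgV => /(free_word_trivial ow) -> /esym; exact: divg1_eq.
Qed.

Lemma free_hom_total g : ggen Bs g -> exists a, free_hom g a.
Proof.
move=> Bg; apply: (@ggen_min _ Bs (fun g => exists a, free_hom g a) _ _ g Bg).
  split; first by exists 1%g; exact: free_hom1.
  move=> x y [a xa] [b yb]; exists (a * b^-1)%g.
  by apply: free_homM => //; exact: free_homV.
by move=> x Bx; exists (phi x); exact: free_hom_basis.
Qed.

End FreeHom.

Lemma ggen_abelian (G : groupType) (P : G -> Prop) :
  (forall x y, P x -> P y -> (x * y)%g = (y * x)%g) -> is_abelian_subgroup (ggen P).
Proof.
move=> comP.
have sub_cent (x : G) : gsubgroup (fun y => commute x y).
  split; first exact: commute1.
  by move=> y z xy xz; apply: commuteM => //; exact: commuteV.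
have step x : P x -> forall y, ggen P y -> commute x y.
  by move=> Px; apply: (ggen_min (sub_cent x)) => y Py; exact: comP.
move=> x y Px Py; have : commute y x.
  by apply: (ggen_min (sub_cent y) _ Px) => z Pz; apply/commute_sym/step.
by move/commute_sym.
Qed.

(* A nilpotent group of class 3: [n] and [a] are the coordinates of the
   abelianisation, and the pairs (b, c) and (b', c') come from the semidirect
   products of Q[t]/t^3 with Q acting by exp(n t), respectively exp(a t). *)
Definition nil3 : Type := ((rat * rat) * ((rat * rat) * (rat * rat)))%type.
HB.instance Definition _ := Choice.on nil3.

Definition nil3_mul (x y : nil3) : nil3 :=
  let: ((n, a), ((b, c), (b', c'))) := x in
  let: ((m, d), ((e, f), (e', f'))) := y in
  ((n + m, a + d),
   ((b + e + n * d, c + f + n * e + n ^+ 2 / 2%:R * d),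
    (b' + e' + a * m, c' + f' + a * e' + a ^+ 2 / 2%:R * m))).
Definition nil3_one : nil3 := ((0, 0), ((0, 0), (0, 0))).
Definition nil3_inv (x : nil3) : nil3 :=
  let: ((n, a), ((b, c), (b', c'))) := x in
  ((- n, - a), ((- b + n * a, - c + n * b - n ^+ 2 / 2%:R * a),
                (- b' + a * n, - c' + a * b' - a ^+ 2 / 2%:R * n))).

Lemma nil3_mulA : associative nil3_mul.
Proof.
move=> [[? ?] [[? ?] [? ?]]] [[? ?] [[? ?] [? ?]]] [[? ?] [[? ?] [? ?]]] /=.
by repeat congr pair; field.
Qed.
Lemma nil3_mul1 : left_id nil3_one nil3_mul.
Proof. by move=> [[? ?] [[? ?] [? ?]]] /=; repeat congr pair; field. Qed.
Lemma nil3_mulr1 : right_id nil3_one nil3_mul.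
Proof. by move=> [[? ?] [[? ?] [? ?]]] /=; repeat congr pair; field. Qed.
Lemma nil3_mulV : left_inverse nil3_one nil3_inv nil3_mul.
Proof. by move=> [[? ?] [[? ?] [? ?]]] /=; rewrite /nil3_one; repeat congr pair; field. Qed.
Lemma nil3_mulrV : right_inverse nil3_one nil3_inv nil3_mul.
Proof. by move=> [[? ?] [[? ?] [? ?]]] /=; rewrite /nil3_one; repeat congr pair; field. Qed.

HB.instance Definition _ :=
  isGroup.Build nil3 nil3_mulA nil3_mul1 nil3_mulr1 nil3_mulV nil3_mulrV.

(** Here z is the conjugate of x by y. With (p, q) and (r, s) the abelianised x and y and D = ps -
    qr, commutation of x and z gives p D = 0 in one semidirect product and q D = 0 in the other. So
    D = 0 unless p = q = 0, when D vanishes anyway. *)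
Lemma nil3_commute (x y z : nil3) : (z * y = y * x)%g -> (x * z = z * x)%g ->
  x.1.1 * y.1.2 = x.1.2 * y.1.1.
Proof.
case: x => [[p q] [[b c] [b' c']]]; case: y => [[r s] [[e f] [e' f']]].
case: z => [[p' q'] [[g h] [g' h']]] [Ep Eq Eg _ Eg' _] [_ _ _ Eh _ Eh'] /=.
have pE : p' = p by apply: (addIr r); rewrite Ep addrC.
have qE : q' = q by apply: (addIr s); rewrite Eq addrC.
subst p' q'.
have gE : g = b + r * q - p * s by apply: (addIr (e + p * s)); rewrite addrA Eg; ring.
have gE' : g' = b' + s * p - q * r.
  by apply: (addIr (e' + q * r)); rewrite addrA Eg'; ring.
have : p * (r * q - p * s) = 0.
  have -> : p * (r * q - p * s) =
    (c + h + p * g + p ^+ 2 / 2%:R * q) - (h + c + p * b + p ^+ 2 / 2%:R * q).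
    by rewrite gE; ring.
  by rewrite Eh subrr.
have : q * (s * p - q * r) = 0.
  have -> : q * (s * p - q * r) =
    (c' + h' + q * g' + q ^+ 2 / 2%:R * p) - (h' + c' + q * b' + q ^+ 2 / 2%:R * p).
    by rewrite gE'; ring.
  by rewrite Eh' subrr.
move=> /eqP; rewrite mulf_eq0 => /orP [/eqP->|/eqP e1 _]; last first.
  by apply/subr0_eq; rewrite -[RHS]e1; ring.
move=> /eqP; rewrite mulf_eq0 => /orP [/eqP->|/eqP e1]; first by rewrite !mul0r.
by apply/subr0_eq; rewrite -[RHS]oppr0 -[in RHS]e1; ring.
Qed.

(* If the free group generated by [a] and [b] has two distinct basis elements,
   map it to [nil3]: the relation forces the images of [a] and [b] to be
   dependent in the abelianisation Q^2, which they generate. *)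
Lemma free_conj_commute (G : groupType) (a b : G) :
  is_free_subgroup (ggen (fun g => g = a \/ g = b)) ->
  commute a (b * a * b^-1)%g -> commute a b.
Proof.
move=> [Bs [BsH [freeBs HBs]]] com.
set H := ggen _ in BsH HBs.
have Ha : H a by move=> K sK; apply; left.
have Hb : H b by move=> K sK; apply; right.
have [[x [y [Bx By xy]]]|one] := pselect (exists x y, [/\ Bs x, Bs y & x <> y]); last first.
  apply: (@ggen_abelian _ Bs) => [x y Bx By||]; [|exact/HBs|exact/HBs].
  by have -> : x = y by apply: contrapT => ne; apply: one; exists x, y.
exfalso; pose X0 : nil3 := ((1, 0), ((0, 0), (0, 0))).
pose Y0 : nil3 := ((0, 1), ((0, 0), (0, 0))).
pose phi z : nil3 := if z == x then X0 else if z == y then Y0 else 1%g.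
have phix : phi x = X0 by rewrite /phi eqxx.
have phiy : phi y = Y0 by rewrite /phi eq_sym; case: eqP => // _; rewrite eqxx.
have hx := free_hom_basis phi Bx; have hy := free_hom_basis phi By.
rewrite phix in hx; rewrite phiy in hy.
have [ka ha] := free_hom_total phi ((HBs a).1 Ha).
have [kb hb] := free_hom_total phi ((HBs b).1 Hb).
have det : ka.1.1 * kb.1.2 = ka.1.2 * kb.1.1.
  pose kc := (kb * ka * kb^-1)%g.
  have hc : free_hom Bs phi (b * a * b^-1)%g kc.
    by apply: free_homM (free_homV hb); exact: free_homM.
  apply: (@nil3_commute _ _ kc); first by rewrite /kc mulgVK.
  apply: (free_hom_unique freeBs (free_homM ha hc)); rewrite com.
  exact: free_homM.
(* A functional on the abelianisation that kills the images of a and b kills that of every element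
   of H, in particular the images (1, 0) and (0, 1) of x and y. *)
have lin (u v : rat) : u * ka.1.1 + v * ka.1.2 = 0 -> u * kb.1.1 + v * kb.1.2 = 0 ->
    u = 0 /\ v = 0.
  move=> ua ub; pose L (k : nil3) := u * k.1.1 + v * k.1.2.
  have LM k k' : L (k * k')%g = L k + L k'.
    case: k k' => [[? ?] [[? ?] [? ?]]] [[? ?] [[? ?] [? ?]]]; rewrite /L /=; ring.
  have LV k : L (k^-1)%g = - L k.
    by case: k => [[? ?] [[? ?] [? ?]]]; rewrite /L /=; ring.
  have LH g : H g -> exists k, free_hom Bs phi g k /\ L k = 0.
    move=> Hg; apply: (@ggen_min _ _ (fun g => exists k, free_hom Bs phi g k /\ L k = 0) _ _ g Hg).
      split; first by exists 1%g; split; [exact: free_hom1|rewrite /L /= !mulr0 addr0].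
      move=> g1 g2 [k1 [h1 L1]] [k2 [h2 L2]]; exists (k1 * k2^-1)%g.
      split; first by apply: free_homM => //; exact: free_homV.
      by rewrite LM LV L1 L2 subrr.
    by move=> _ [->|->]; [exists ka|exists kb].
  have [kx [hkx]] := LH x (BsH _ Bx); rewrite -(free_hom_unique freeBs hx hkx).
  have [ky [hky]] := LH y (BsH _ By); rewrite -(free_hom_unique freeBs hy hky).
  by rewrite /L /= !mulr0 !mulr1 addr0 add0r => -> ->.
(* The functional (-q, p) built from the image (p, q) of a kills a trivially and b by [det]. Hence p
   = q = 0, and the same with b shows that both images vanish. *)
have [/eqP] : - ka.1.2 = 0 /\ ka.1.1 = 0.
  by apply: lin; [ring|rewrite det; ring].
rewrite oppr_eq0 => /eqP q0 p0.
have [/eqP] : - kb.1.2 = 0 /\ kb.1.1 = 0.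
  by apply: lin; [rewrite q0 p0 !mulr0 addr0|ring].
rewrite oppr_eq0 => /eqP s0 r0.
have [] := lin 1 0; last by move/eqP; rewrite oner_eq0.
  by rewrite p0 q0 !mulr0 addr0.
by rewrite r0 s0 !mulr0 addr0.
Qed.

Lemma two_gen_conj_commute (G : groupType) (a b : G) :
  two_gen_free_or_abelian G -> commute a (b * a * b^-1)%g -> commute a b.
Proof.
move=> two com; have [fr|ab] := two a b; first exact: free_conj_commute.
by apply: ab => K sK; apply; [left|right].
Qed.

(** * Torsion-free abelian groups of finite rank *)

Section AdditiveMaps.
Variables (X Y : zmodType) (f : X -> Y).
Hypothesis fD : forall x y, f (x + y) = f x + f y.

Lemma addf0 : f 0 = 0. Proof. by apply: (addrI (f 0)); rewrite -fD !addr0. Qed.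
Lemma addfN x : f (- x) = - f x.
Proof. by apply: (addrI (f x)); rewrite -fD !subrr addf0. Qed.
Lemma addfB x y : f (x - y) = f x - f y. Proof. by rewrite fD addfN. Qed.
Lemma addfMn x n : f (x *+ n) = f x *+ n.
Proof. by elim: n => [|n IHn]; rewrite ?mulr0n ?addf0 // !mulrS fD IHn. Qed.
Lemma addfMz x (z : int) : f (x *~ z) = f x *~ z.
Proof. by case: z => n; rewrite ?NegzE ?mulrNz ?addfN addfMn. Qed.
Lemma addf_sum (I : Type) (r : seq I) (P : pred I) (E : I -> X) :
  f (\sum_(i <- r | P i) E i) = \sum_(i <- r | P i) f (E i).
Proof. exact: (big_morph f fD addf0). Qed.
End AdditiveMaps.

Lemma rat_torsion_free (V : lmodType rat) (v : V) n : (0 < n)%N -> v *+ n = 0 -> v = 0.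
Proof.
move=> n0; rewrite -scaler_nat => /eqP; rewrite scaler_eq0 pnatr_eq0.
by rewrite eqn0Ngt n0 /= => /eqP.
Qed.

Lemma rat_mulIn (V : lmodType rat) (v w : V) n : (0 < n)%N -> v *+ n = w *+ n -> v = w.
Proof.
move=> n0 vw; apply: subr0_eq; apply: (rat_torsion_free n0).
by rewrite mulrnBl vw subrr.
Qed.

Lemma rat_additive_linear (V W : lmodType rat) (f : V -> W) :
  (forall x y, f (x + y) = f x + f y) -> forall q v, f (q *: v) = q *: f v.
Proof.
move=> fD q v; have d0 : (0 < `|denq q|)%N by rewrite absz_gt0 denq_neq0.
apply: (rat_mulIn d0); rewrite -(addfMn fD) -!scaler_nat !scalerA.
have -> : (`|denq q|%:R : rat) * q = (numq q)%:~R.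
  by rewrite -{2}(divq_num_den q) pmulrn absz_denq mulrC divfK // intr_eq0 denq_neq0.
by rewrite !scaler_int (addfMz fD).
Qed.

Lemma mulrnzAC (X : zmodType) (x : X) n (z : int) : (x *+ n) *~ z = (x *~ z) *+ n.
Proof. by rewrite !pmulrn mulrzAC. Qed.

Section TorsionFreeRank.
Variables (X : zmodType) (M : X -> Prop).
Hypotheses (tf : torsion_free_on M) (sM : zsubgroup M).

Lemma tf_mulIn x y n : (0 < n)%N -> M x -> M y -> x *+ n = y *+ n -> x = y.
Proof.
move=> n0 Mx My xy; apply: subr0_eq; apply: (tf _ n0); first exact: zsubB.
by rewrite mulrnBl xy subrr.
Qed.

Variables (d : nat) (e : 'I_d -> X).

Definition comb (k : 'rV[int]_d) : X := \sum_i e i *~ k 0 i.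

Lemma combD k l : comb (k + l) = comb k + comb l.
Proof. by rewrite -big_split; apply: eq_bigr => i _; rewrite mxE mulrzDr. Qed.

Lemma combZ z k : comb (z *: k) = comb k *~ z.
Proof. by rewrite mulrz_suml; apply: eq_bigr => i _; rewrite mxE mulrC mulrzA. Qed.

Lemma comb_sum (I : Type) (r : seq I) (P : pred I) (E : I -> 'rV[int]_d) :
  comb (\sum_(i <- r | P i) E i) = \sum_(i <- r | P i) comb (E i).
Proof. exact: (addf_sum combD). Qed.

Hypothesis be : qbasis M e.

Lemma comb_mem k : M (comb k).
Proof. by apply: zsub_sum => // i _; apply: zsubMz => //; case: be. Qed.

Lemma comb_eq0 k : comb k = 0 -> k = 0.
Proof.
move=> k0; apply/rowP => i; rewrite mxE; case: be => _ [indep _].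
by apply: (indep (fun i => k 0 i)); exists 1%N; split.
Qed.

Lemma comb_cover x : M x -> exists n k, (0 < n)%N /\ x *+ n = comb k.
Proof.
case: be => _ [_ cov] /cov [n [n0 [k kE]]]; exists n, (\row_i k i); split => //.
by rewrite kE; apply: eq_bigr => i _; rewrite mxE.
Qed.

Lemma comb_cover_family (r : nat) (x : 'I_r -> X) : (forall i, M (x i)) ->
  exists n (N : 'M[int]_(r, d)), (0 < n)%N /\ forall i, x i *+ n = comb (row i N).
Proof.
move=> Mx; have /choice[nk nkP] i : exists nk : nat * 'rV[int]_d,
    (0 < nk.1)%N /\ x i *+ nk.1 = comb nk.2.
  by have [n [k ?]] := comb_cover (Mx i); exists (n, k).
exists (\prod_i (nk i).1)%N, (\matrix_i ((\prod_(l | l != i) (nk l).1)%N%:Z *: (nk i).2)).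
split; first by rewrite prodn_gt0 // => i; exact: (nkP i).1.
by move=> i; rewrite (bigD1 i) //= mulrnA (nkP i).2 rowK combZ -pmulrn.
Qed.

Variables (f : X -> X).
Hypothesis fD : forall x y, f (x + y) = f x + f y.

Section MatrixOfMap.
Variables (m : nat) (N : 'M[int]_d).
Hypothesis fN : forall i, f (e i) *+ m = comb (row i N).

Lemma comb_map k : f (comb k) *+ m = comb (k *m N).
Proof.
rewrite (addf_sum fD) -sumrMnl mulmx_sum_row comb_sum; apply: eq_bigr => i _.
by rewrite combZ -fN (addfMz fD) mulrnzAC.
Qed.
End MatrixOfMap.

End TorsionFreeRank.

Section CayleyHamilton.
Variables (X : zmodType) (M : X -> Prop).
Hypotheses (tf : torsion_free_on M) (sM : zsubgroup M).
Variables (d : nat) (e : 'I_d.+1 -> X).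
Hypothesis be : qbasis M e.
Variables (f : X -> X).
Hypotheses (fD : forall x y, f (x + y) = f x + f y) (fM : forall x, M x -> M (f x)).
Variables (m : nat) (N : 'M[int]_d.+1).
Hypothesis fN : forall i, f (e i) *+ m = comb e (row i N).

Let g x := f x *+ m.

Lemma iter_scaled_additive n x y : iter n g (x + y) = iter n g x + iter n g y.
Proof. by elim: n => //= n ->; rewrite /g fD mulrnDl. Qed.

Lemma iter_scaled_mem n x : M x -> M (iter n g x).
Proof. by move=> Mx; elim: n => //= n IHn; apply: zsubMn => //; exact: fM. Qed.

Lemma iter_scaled_comb n k : iter n g (comb e k) = comb e (k *m N ^+ n).
Proof.
elim: n => [|n IHn] /=; first by rewrite expr0 mulmx1.
by rewrite IHn /g (comb_map fD fN) exprSr mulmxA.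
Qed.

Lemma iter_scaled n x : iter n g x = iter n f x *+ m ^ n.
Proof.
elim: n => [|n IHn] /=; first by rewrite expn0.
by rewrite IHn /g (addfMn fD) -mulrnA expnSr.
Qed.

(** Only m f has an integer matrix in the basis e, which is why [g] replaces f. The relation is
    checked on a multiple n x in the lattice spanned by e, and n is cancelled by
    torsion-freeness. *)
Lemma horner_annihilates (p : {poly int}) : horner_mx N p = 0 ->
  forall x, M x -> \sum_(i < size p) iter i g x *~ p`_i = 0.
Proof.
move=> pN x Mx; have [n [k [n0 xk]]] := comb_cover be Mx; apply: (tf _ n0).
  by apply: zsub_sum => // i _; apply: zsubMz => //; exact: iter_scaled_mem.
rewrite -sumrMnl (eq_bigr (fun i : 'I_(size p) => comb e (k *m (p`_i *: N ^+ i)))).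
  rewrite -comb_sum -mulmx_sumr.
  suff -> : \sum_(i < size p) p`_i *: N ^+ i = horner_mx N p.
    by rewrite pN mulmx0 /comb big1 // => i _; rewrite mxE mulr0z.
  rewrite -[p in RHS]coefK poly_def rmorph_sum; apply: eq_bigr => i _ /=.
  by rewrite linearZ /= rmorphXn /= horner_mx_X.
move=> i _; rewrite -scalemxAr combZ -iter_scaled_comb -xk.
by rewrite (addfMn (iter_scaled_additive i)) mulrnzAC.
Qed.

End CayleyHamilton.

(* Cayley-Hamilton: the constant term of the characteristic polynomial, which
   is nonzero by injectivity, is a multiple of [f] in the ring generated by a
   multiple of [f]. *)
Lemma injective_endo_index (X : zmodType) (M : X -> Prop) (f : X -> X) :
  torsion_free_on M -> zsubgroup M -> finite_rank M ->
  (forall x y, f (x + y) = f x + f y) -> (forall x, M x -> M (f x)) ->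
  (forall x, M x -> f x = 0 -> x = 0) ->
  exists n, (0 < n)%N /\ forall x, M x -> exists y, M y /\ x *+ n = f y.
Proof.
move=> tf sM [d [e be]] fD fM finj; case: d e be => [|d] e be.
  exists 1%N; split => // x Mx; exists x; split => //.
  suff -> : x = 0 by rewrite (addf0 fD).
  by have [n [k [n0 xk]]] := comb_cover be Mx; apply: (tf _ _ Mx n0); rewrite xk /comb big_ord0.
have [|m [N [m0 fN]]] := @comb_cover_family _ _ _ _ be _ (fun i => f (e i)).
  by move=> i; apply: fM; case: be.
pose g x := f x *+ m.
have det0 : \det N != 0.
  apply/negP => /det0P [k k0 kN]; case/eqP: k0; apply: (comb_eq0 be).
  apply: finj; first exact: comb_mem.
  apply: (tf _ m) => //; first by apply: fM; exact: (comb_mem sM be).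
  by rewrite (comb_map fD fN) kN /comb big1 // => i _; rewrite mxE mulr0z.
set p := char_poly N; pose z := p`_0.
have z0 : z != 0 by rewrite /z char_poly_det mulf_neq0 // expf_neq0.
exists `|z|%N; rewrite absz_gt0; split => // x Mx.
have := horner_annihilates tf sM be fD fM fN (Cayley_Hamilton N) Mx.
rewrite size_char_poly big_ord_recl /= -/p -/z.
set s := \sum_i _ => sE.
pose y := \sum_(i < d.+1) iter i g x *~ p`_(lift ord0 i).
have sy : s = f (y *+ m).
  rewrite (addfMn fD) (addf_sum fD) -sumrMnl; apply: eq_bigr => i _.
  by rewrite (addfMz fD) -mulrnzAC.
have My : M y.
  by apply: zsub_sum => // i _; apply: zsubMz => //; exact: iter_scaled_mem.
exists (y *+ m *~ - sgz z); split.
  by apply: zsubMz => //; exact: zsubMn.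
(* Since f(m y) = s = -z x, the factor -sgn(z) produces |z| x. *)
rewrite (addfMz fD) -sy mulrNz -mulNrz.
have -> : - s = x *~ z by apply/esym/eqP; rewrite -addr_eq0 sE.
by rewrite -mulrzA mulrC -abszEsg.
Qed.

(** Cayley-Hamilton applied to a polynomial with two terms: mu f^delta = nu on M. The rational
    identity is cleared of the denominator m to become one of integer matrices. *)
Lemma charpoly_power (X : zmodType) (M : X -> Prop) (f : X -> X) p (mu nu delta : nat) :
  torsion_free_on M -> zsubgroup M ->
  (forall x y, f (x + y) = f x + f y) -> (forall x, M x -> M (f x)) ->
  charpoly_on f M p -> mu%:R *: p = mu%:R *: 'X^delta - (nu%:R)%:P ->
  forall x, M x -> iter delta f x *+ mu = x *+ nu.
Proof.
move=> tf sM fD fM [d [e [be [N [m [m0 [fN pE]]]]]]] muE x Mx.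
have fNr i : f (e i) *+ m = comb e (row i N).
  by rewrite fN; apply: eq_bigr => j _; rewrite mxE.
case: d e be N fN fNr pE => [|d] e be N fN fNr pE.
  have -> : x = 0.
    by have [n [k [n0 xk]]] := comb_cover be Mx; apply: (tf _ _ Mx n0); rewrite xk /comb big_ord0.
  have -> : iter delta f 0 = 0 by elim: delta {muE} => //= n ->; exact: addf0.
  by rewrite !mul0rn.
have mN0 : (m%:R : rat) != 0 by rewrite pnatr_eq0 -lt0n.
have NE : map_mx (fun z : int => (z%:~R : rat) / m%:R) N = m%:R^-1 *: map_mx intr N.
  by apply/matrixP => i j; rewrite !mxE mulrC.
have CH : mu%:R *: (map_mx intr N : 'M[rat]_d.+1) ^+ delta = (nu%:R * m%:R ^+ delta)%:M.
  have := Cayley_Hamilton (m%:R^-1 *: map_mx intr N : 'M[rat]_d.+1).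
  rewrite -NE -pE => /(congr1 (fun Q => mu%:R *: Q)); rewrite scaler0 -linearZ /= muE NE.
  rewrite rmorphB /= linearZ /= rmorphXn /= horner_mx_X horner_mx_C => /subr0_eq.
  rewrite exprZn scalerA mulrC -scalerA => /(congr1 (fun Q => m%:R ^+ delta *: Q)).
  rewrite !scalerA mulrA -exprMn mulfV // expr1n mul1r => ->.
  by rewrite scale_scalar_mx mulrC.
have CHz : mu%:Z *: N ^+ delta = (nu%:Z * m%:Z ^+ delta)%:M.
  suff /matrixP E : map_mx intr (mu%:Z *: N ^+ delta) =
      map_mx intr (nu%:Z * m%:Z ^+ delta)%:M :> 'M[rat]_d.+1.
    by apply/matrixP => i l; have := E i l; rewrite !mxE => /intr_inj.
  rewrite map_mxZ map_scalar_mx /= rmorphM /= !rmorphXn /= -!pmulrn; exact: CH.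
have [n [k [n0 xk]]] := comb_cover be Mx.
have Mit : M (iter delta f x) by elim: (delta) => //= l; exact: fM.
have md0 : (0 < m ^ delta * n)%N by rewrite muln_gt0 expn_gt0 m0.
apply: (tf_mulIn tf sM md0); try exact: zsubMn.
have := iter_scaled_comb fD fNr delta (mu%:Z *: k).
rewrite -scalemxAl scalemxAr CHz mul_mx_scalar !combZ -xk.
rewrite (iter_scaled fD) -!pmulrn.
have itMn l z : iter delta f (z *+ l) = iter delta f z *+ l.
  by elim: (delta) => //= i ->; rewrite (addfMn fD).
have -> : (nu%:Z * m%:Z ^+ delta) = (nu * m ^ delta)%N%:Z.
  by rewrite PoszM; congr (_ * _); elim: (delta) => // i IH; rewrite exprS expnS PoszM IH.
rewrite -pmulrn !itMn -!mulrnA => itE.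
transitivity (iter delta f x *+ (n * (mu * m ^ delta))); first by congr (_ *+ _); lia.
rewrite itE; congr (_ *+ _); lia.
Qed.

(** * Finiteness of X/nX in finite rank *)

Section FiniteQuotient.
Variables (X : zmodType).
Hypotheses (tf : torsion_free_on (fun _ : X => True)) (fr : finite_rank (fun _ : X => True)).

Definition finite_mod (n : nat) :=
  exists reps : seq X, forall x, exists r y, List.In r reps /\ x = r + y *+ n.

Definition mod_independent (p r : nat) (x : 'I_r -> X) :=
  forall k : 'rV[int]_r, (exists y, comb x k = y *+ p) -> forall i, (p%:Z %| (k 0 i)%R)%Z.

Lemma mod_independent_bound p r (x : 'I_r -> X) : prime p -> mod_independent p x ->
  forall d (e : 'I_d -> X), qbasis (fun _ : X => True) e -> (r <= d)%N.
Proof.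
move=> pp ind d e be; rewrite leqNgt; apply/negP => dr.
have [n [N [n0 NE]]] := comb_cover_family be (fun i : 'I_r => I : (fun=> True) (x i)).
(* Padding with zero columns, possible as r > d, gives a singular square matrix and hence a nonzero
   integral relation. *)
pose N' : 'M[int]_r := \matrix_(i, j) if insub (val j) is Some l then N i l else 0.
have : \det N' == 0.
  rewrite (expand_det_col _ (Ordinal dr)) big1 // => i _.
  by rewrite mxE insubF /= ?ltnn // mul0r.
case/det0P => k k0 kN'.
have kN : k *m N = 0.
  apply/rowP => l; have lr : (l < r)%N by apply: ltn_trans dr.
  have := congr1 (fun Q : 'rV[int]_r => Q 0 (Ordinal lr)) kN'; rewrite !mxE => {2}<-.
  by apply: eq_bigr => i _; rewrite mxE /= insubT // => ld; congr (_ * N i _); exact: val_inj.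
have xk0 : comb x k = 0.
  apply: (tf I n0); have kNe : comb e (k *m N) = 0.
    by rewrite kN /comb big1 // => i _; rewrite mxE mulr0z.
  rewrite -sumrMnl -[RHS]kNe mulmx_sum_row comb_sum; apply: eq_bigr => i _.
  by rewrite combZ -NE mulrnzAC.
(* Descent: independence modulo p makes every relation divisible by p, and torsion-freeness makes
   the quotient a relation again. The exponent |k_i| suffices below, as p^|k_i| > |k_i|. *)
have div_all j (l : 'rV[int]_r) : comb x l = 0 -> forall i, (p%:Z ^+ j %| (l 0 i)%R)%Z.
  elim: j l => [|j IHj] l l0 i; first by rewrite expr0 dvd1z.
  have dvl : forall i, (p%:Z %| (l 0 i)%R)%Z by apply: ind; exists 0; rewrite mul0rn.
  pose l' : 'rV[int]_r := \row_i ((l 0 i)%R %/ p%:Z)%Z.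
  have ll' : l = p%:Z *: l' by apply/rowP => i'; rewrite !mxE mulrC divzK.
  have l'0 : comb x l' = 0.
    by apply: (tf I (prime_gt0 pp)); rewrite pmulrn -combZ -ll'.
  by rewrite ll' mxE exprS dvdz_mul // IHj.
case/eqP: k0; apply/rowP => i; rewrite mxE; apply: contrapT => /eqP ki0.
have := div_all `|(k 0 i)%R|%N k xk0 i; rewrite /dvdz abszX absz_nat.
move/dvdn_leq; rewrite absz_gt0 ki0 => /(_ isT); rewrite leqNgt => /negP; apply.
by apply: ltn_expl; exact: prime_gt1.
Qed.

(** A maximal family independent modulo p spans X/pX: adjoining any y creates a relation whose
    coefficient at y is prime to p, and Bezout solves it for y modulo p. *)
Lemma finite_mod_prime p : prime p -> finite_mod p.
Proof.
move=> pp; have [d [e be]] := fr.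
pose P r := `[< exists x : 'I_r -> X, mod_independent p x >].
have P0 : exists r, P r by exists 0%N; apply/asboolP; exists (fun=> 0) => k _ i; have := ltn_ord i.
have Pd r : P r -> (r <= d)%N by move/asboolP => [x xi]; exact: (mod_independent_bound pp xi be).
case: (ex_maxnP P0 Pd) => r /asboolP [x xi] rmax.
exists [seq \sum_i x i *+ val (h i) | h : {ffun 'I_r -> 'I_p} <- enum {ffun 'I_r -> 'I_p}] => y.
pose x' (i : 'I_r.+1) := if unlift ord0 i is Some l then x l else y.
have x'E (k : 'rV[int]_r.+1) : comb x' k = y *~ k 0 ord0 + comb x (\row_l k 0 (lift ord0 l)).
  rewrite /comb big_ord_recl /x' unlift_none; congr (_ + _).
  by apply: eq_bigr => l _; rewrite liftK mxE.
have [k [z kz] nk] : exists2 k : 'rV[int]_r.+1, exists z, comb x' k = z *+ p &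
    ~ forall i, (p%:Z %| (k 0 i)%R)%Z.
  apply: contrapT => no; suff /rmax : P r.+1 by rewrite ltnn.
  apply/asboolP; exists x' => k kz; apply: contrapT => nk; apply: no.
  by exists k.
rewrite x'E in kz; set l := \row_l _ in kz.
(* If p divided the coefficient of y, the rest would be a relation modulo p among the x_i, so p
   would divide all coefficients. *)
have cop : coprimez (k 0 ord0) p%:Z.
  rewrite coprimez_sym /coprimez; apply/negPn/negP => ncop; apply: nk.
  have dk : (p%:Z %| (k 0 ord0)%R)%Z.
    by move: ncop; rewrite -[_ == _]/(coprime p `|(k 0 ord0)%R|) prime_coprime // negbK.
  have dl : forall i, (p%:Z %| (l 0 i)%R)%Z.
    apply: xi; exists (z - y *~ ((k 0 ord0)%R %/ p%:Z)%Z).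
    rewrite mulrnBl -kz -mulrnzAC [y *+ p]pmulrn -mulrzA [p%:Z * _]mulrC divzK //.
    by rewrite addrC addKr.
  move=> i; case: (unliftP ord0 i) => [i' ->|-> //].
  by have := dl i'; rewrite mxE.
have /coprimezP [[u v] /= uv] := cop.
pose c := - u *: l.
have yE : y = comb x c + (z *~ u + y *~ v) *+ p.
  have e1 : y *~ k 0 ord0 *~ u = z *~ u *+ p - comb x l *~ u.
    by rewrite -mulrnzAC -kz mulrzDl addrK.
  rewrite /c combZ mulrNz mulrnDl -[LHS](mulr1z y) -uv mulrzDr [u * _]mulrC !mulrzA e1.
  by rewrite -[y *~ v *~ p]pmulrn addrA [- _ + _]addrC.
pose q := \row_i ((c 0 i)%R %/ p%:Z)%Z : 'rV[int]_r.
have qE i : q 0 i = ((c 0 i)%R %/ p%:Z)%Z by rewrite /q mxE.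
have p0 : p%:Z != 0 by rewrite -lt0n prime_gt0.
have hP i : (`|((c 0 i)%R %% p%:Z)%Z| < p)%N.
  by rewrite -ltz_nat gez0_abs ?modz_ge0 // ltz_pmod // ltz_nat prime_gt0.
pose h := [ffun i => Ordinal (hP i)].
exists (\sum_i x i *+ val (h i)), (comb x q + (z *~ u + y *~ v)); split.
  have mem_In (T : eqType) (t : T) (s : seq T) : t \in s -> List.In t s.
    by elim: s => //= t' s IH; rewrite inE => /orP [/eqP ->|/IH]; [left|right].
  apply: (@List.in_map _ _ (fun h : {ffun 'I_r -> 'I_p} => \sum_i x i *+ val (h i))).
  by apply: mem_In; rewrite mem_enum.
rewrite {1}yE [(comb x q + _) *+ p]mulrnDl addrA; congr (_ + _).
rewrite /comb -sumrMnl -big_split; apply: eq_bigr => i _ /=.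
rewrite ffunE /= qE [x i *+ _]pmulrn gez0_abs ?modz_ge0 // -mulrnzAC [x i *+ p]pmulrn -mulrzA.
by rewrite -mulrzDr addrC [p%:Z * _]mulrC -divz_eq.
Qed.

Lemma finite_mod_pos n : (0 < n)%N -> finite_mod n.
Proof.
have [m] := ubnP n; elim: m n => // m IHm n; rewrite ltnS => nm n0.
have [n1|n1] := leqP n 1.
  have -> : n = 1%N by apply/eqP; rewrite eqn_leq n1.
  by exists [:: 0] => x; exists 0, x; rewrite add0r mulr1n; split => //; left.
have pp := pdiv_prime n1; have pn := pdiv_dvd n.
have [rs rsP] := finite_mod_prime pp.
have [||rs' rsP'] := IHm (n %/ pdiv n)%N.
- by apply: leq_trans nm; rewrite ltn_Pdiv // prime_gt1.
- by rewrite divn_gt0 ?prime_gt0 // dvdn_leq.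
exists (List.flat_map (fun r => List.map (fun r' => r + r' *+ pdiv n) rs') rs) => x.
have [r [y [inr xE]]] := rsP x; have [r' [y' [inr' yE]]] := rsP' y.
exists (r + r' *+ pdiv n), y'; split.
  by apply/List.in_flat_map; exists r; split => //; apply/List.in_map_iff; exists r'.
by rewrite xE yE mulrnDl addrA -mulrnA divnK.
Qed.

End FiniteQuotient.

(** The injective endomorphism f f' of Y has nY in its image for some n > 0, hence nY lies in f(X),
    and Y/nY is finite. *)
Lemma finite_index_mutual (X Y : zmodType) (f : X -> Y) (f' : Y -> X) :
  torsion_free_on (fun _ : Y => True) -> finite_rank (fun _ : Y => True) ->
  (forall x y, f (x + y) = f x + f y) -> injective f ->
  (forall x y, f' (x + y) = f' x + f' y) -> injective f' -> emb_finite_index f.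
Proof.
move=> tf fr fD fI fD' fI'.
have [||//||n [n0 nP]] := @injective_endo_index Y (fun=> True) (f \o f') tf _ fr.
- by [].
- by move=> x y /=; rewrite fD' fD.
- move=> x _ /= fx; apply/fI'/fI; rewrite fx (addf0 fD') (addf0 fD).
  by [].
have [reps repsP] := finite_mod_pos tf fr n0.
exists reps => y; have [r [z [inr yE]]] := repsP y; exists r; split => //.
by have [w [_ wE]] := nP z I; exists (f' w); rewrite yE addrC addKr wE.
Qed.

Definition coordinates (V : lmodType rat) d (dec : 'rV[rat]_d -> V) (enc : V -> 'rV[rat]_d) :=
  [/\ forall u v, dec (u + v) = dec u + dec v, cancel dec enc & cancel enc dec].

Lemma coordinates_encD (V : lmodType rat) d (dec : 'rV[rat]_d -> V) enc :
  coordinates dec enc -> forall u v, enc (u + v) = enc u + enc v.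
Proof. by case=> decD dK eK u v; rewrite -{1}(eK u) -{1}(eK v) -decD dK. Qed.

Lemma hull_coordinates (G : groupType) (X : zmodType) (act : G -> X -> X)
    (V : lmodType rat) (j : X -> V) (dact : G -> V -> V) :
  rational_hull act j dact -> finite_rank (fun _ : X => True) ->
  exists d (dec : 'rV[rat]_d -> V) enc, coordinates dec enc.
Proof.
move=> [jD [jI [jcov _]]] [d [e be]].
pose dec (r : 'rV[rat]_d) := \sum_i r 0 i *: j (e i).
have decD u v : dec (u + v) = dec u + dec v.
  by rewrite -big_split; apply: eq_bigr => i _; rewrite mxE scalerDl.
have decI u : dec u = 0 -> u = 0.
  move=> u0; pose D := \prod_i denq (u 0 i).
  have D0 : D != 0 by apply/prodf_neq0 => i _; exact: denq_neq0.
  pose k : 'rV[int]_d := \row_i (numq (u 0 i) * \prod_(l | l != i) denq (u 0 l)).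
  have kE i : (k 0 i)%:~R = D%:~R * u 0 i :> rat.
    have -> : D = denq (u 0 i) * \prod_(l | l != i) denq (u 0 l) by rewrite /D (bigD1 i).
    rewrite mxE !intrM -{3}(divq_num_den (u 0 i)).
    by field; rewrite intr_eq0 denq_neq0.
  have k0 : k = 0.
    apply: (comb_eq0 be); apply: jI; rewrite (addf0 jD) (addf_sum jD).
    transitivity ((D%:~R : rat) *: dec u); last by rewrite u0 scaler0.
    rewrite scaler_sumr; apply: eq_bigr => i _.
    by rewrite (addfMz jD) -scaler_int kE scalerA.
  apply/rowP => i; move/rowP: k0 => /(_ i) k0; have := kE i; rewrite k0 !mxE.
  by move=> /esym/eqP; rewrite mulf_eq0 intr_eq0 (negbTE D0) => /eqP.
have /choice[enc encK] v : exists u, dec u = v.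
  have [m [m0 [x vx]]] := jcov v.
  have [n [k [n0 xk]]] := comb_cover be (I : (fun=> True) x).
  exists (\row_i ((k 0 i)%:~R / (m * n)%:R)).
  apply: (@rat_mulIn _ _ _ (m * n)%N); first by rewrite muln_gt0 m0.
  rewrite [RHS]mulrnA vx -(addfMn jD) xk (addf_sum jD) -sumrMnl; apply: eq_bigr => i _.
  rewrite mxE -scaler_nat scalerA mulrC divfK ?scaler_int ?(addfMz jD) //.
  by rewrite pnatr_eq0 -lt0n muln_gt0 m0.
exists d, dec, enc; split => // u; apply: subr0_eq; apply: decI.
by rewrite (addfB decD) encK subrr.
Qed.

Lemma additive_row_matrix (d d' : nat) (h : 'rV[rat]_d -> 'rV[rat]_d') :
  (forall u v, h (u + v) = h u + h v) -> exists P : 'M[rat]_(d, d'), forall u, h u = u *m P.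
Proof.
move=> hD; exists (\matrix_i h (delta_mx 0 i)) => u.
rewrite {1}[u]row_sum_delta (addf_sum hD) mulmx_sum_row; apply: eq_bigr => i _.
by rewrite (rat_additive_linear hD) rowK.
Qed.

Section InjectiveMaps.
Variables (V W : lmodType rat) (h : V -> W) (d d' : nat).
Variables (dec : 'rV[rat]_d -> V) (enc : V -> 'rV[rat]_d).
Variables (dec' : 'rV[rat]_d' -> W) (enc' : W -> 'rV[rat]_d').
Hypotheses (cV : coordinates dec enc) (cW : coordinates dec' enc').
Hypotheses (hD : forall u v, h (u + v) = h u + h v) (hI : injective h).

Lemma injective_row_free : exists P : 'M[rat]_(d, d'),
  row_free P /\ forall u, enc' (h (dec u)) = u *m P.
Proof.
have [decD dK eK] := cV; have [decD' dK' eK'] := cW.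
have [|P PE] := @additive_row_matrix d d' (fun u => enc' (h (dec u))).
  by move=> u v; rewrite decD hD (coordinates_encD cW).
exists P; split => //; rewrite -kermx_eq0; apply/eqP/row_matrixP => i.
rewrite row0; apply: (can_inj dK); apply: hI; apply: (can_inj eK').
rewrite !PE mul0mx -row_mul mulmx_ker row0.
by [].
Qed.

Lemma injective_dim_le : (d <= d')%N.
Proof. by have [P [rfP _]] := injective_row_free; have := rank_leq_col P; rewrite (eqP rfP). Qed.

Lemma injective_dim_full : d = d' -> emb_full h.
Proof.
have [decD dK eK] := cV; have [decD' dK' eK'] := cW.
have [P [rfP PE]] := injective_row_free => dd'; have full : row_full P.
  by rewrite /row_full (eqP rfP) dd'.
have [Q QP] := row_fullP full.
move=> y; exists (dec (enc' y *m Q)); apply: (can_inj eK').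
by rewrite PE -mulmxA QP mulmx1.
Qed.

End InjectiveMaps.

(* The eigenvalues of P over the algebraic numbers are permuted by the q-th
   power map, hence are roots of unity. *)
Lemma conj_power_fixed_vector d (P Q : 'M[rat]_d.+1) q : (1 < q)%N ->
  P \in unitmx -> Q \in unitmx -> P ^+ q *m Q = Q *m P ->
  exists r (u : 'rV[rat]_d.+1), [/\ (0 < r)%N, u != 0 & u *m P ^+ r = u].
Proof.
move=> q1 uP uQ PQ.
pose toC : {rmorphism rat -> algC} := @ratr algC.
pose PC := map_mx toC P; pose QC := map_mx toC Q.
have PQC : PC ^+ q *m QC = QC *m PC.
  by rewrite -map_mxM -PQ map_mxM rmorphXn.
have uPC : PC \in unitmx by rewrite map_unitmx.
have uQC : QC \in unitmx by rewrite map_unitmx.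
have pow (v : 'rV[algC]_d.+1) (a : algC) n : v *m PC = a *: v -> v *m PC ^+ n = a ^+ n *: v.
  move=> va; elim: n => [|n IHn]; first by rewrite !expr0 mulmx1 scale1r.
  by rewrite exprSr -[_ * _]/(_ *m _) mulmxA IHn -scalemxAl va scalerA -exprSr.
(* If v is an eigenvector for a, then v Q P = v P^q Q = a^q v Q. *)
have step (a : algC) : eigenvalue PC a -> eigenvalue PC (a ^+ q).
  move=> /eigenvalueP [v va v0]; apply/eigenvalueP; exists (v *m QC).
    by rewrite -mulmxA -PQC mulmxA (pow _ _ _ va) scalemxAl.
  by apply: contra v0 => /eqP vQ; rewrite -(mulmxK uQC v) vQ mul0mx.
have [a ra] : exists a, root (char_poly PC) a.
  by apply/closed_rootP; rewrite size_char_poly.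
have ev n : eigenvalue PC (a ^+ (q ^ n)).
  elim: n => [|n IHn]; first by rewrite expn0 expr1 eigenvalue_root_char.
  by rewrite expnSr exprM; exact: step.
have a0 : a != 0.
  apply/eqP => a0; have /eigenvalueP [v] := ev 0%N.
  rewrite expn0 expr1 a0 scale0r => /(congr1 (mulmx^~ (invmx PC))).
  by rewrite mulmxK // mul0mx => ->; rewrite eqxx.
(* The d + 2 listed powers are all roots of a characteristic polynomial of degree d + 1. *)
have [i [j [ij aij]]] : exists i j, (i < j)%N /\ a ^+ (q ^ i) = a ^+ (q ^ j).
  pose rs := [seq a ^+ (q ^ i) | i <- seq.iota 0 d.+2].
  have : ~~ uniq rs.
    apply/negP => urs; have := max_poly_roots (p := char_poly PC) (rs := rs).
    rewrite monic_neq0 ?char_poly_monic // size_char_poly size_map size_iota ltnn.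
    move=> /(_ isT) H; suff : false by []; apply: H => //.
    by apply/allP => b /mapP [i _ ->]; rewrite -eigenvalue_root_char.
  move/(uniqPn 0) => [i [j [ij]]]; rewrite size_map size_iota => jn.
  rewrite !(nth_map 0%N) ?size_iota ?(ltn_trans ij) // !nth_iota ?(ltn_trans ij) // !add0n.
  by move=> aij; exists i, j.
have qij : (q ^ i < q ^ j)%N by rewrite ltn_exp2l.
pose r := (q ^ j - q ^ i)%N; have r0 : (0 < r)%N by rewrite subn_gt0.
have ar : a ^+ r = 1.
  apply: (mulfI (expf_neq0 (q ^ i) a0)); rewrite mulr1 -exprD subnKC ?aij //.
  exact: ltnW.
have /eigenvalueP [v va v0] := ev 0%N; rewrite expn0 expr1 in va.
(* Eigenvalue 1 of P^r is a determinant condition, which descends from the algebraic numbers to Q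
   and yields a rational fixed vector. *)
have : \det (P ^+ r - 1%:M) == 0.
  rewrite -(fmorph_eq0 toC) -det_map_mx map_mxB map_mx1 rmorphXn /=; apply/det0P.
  by exists v => //; rewrite mulmxBr mulmx1 (pow _ _ _ va) ar scale1r subrr.
case/det0P => u u0; rewrite mulmxBr mulmx1 => /subr0_eq uE.
by exists r, u.
Qed.

(** * The fibre homomorphism of a cocycle *)

Section Hull.
Variables (G : groupType) (X : zmodType) (act : G -> X -> X).
Variables (V : lmodType rat) (j : X -> V) (dact : G -> V -> V).
Hypotheses (aact : is_gaction act) (hull : rational_hull act j dact).

Lemma hullD x y : j (x + y) = j x + j y. Proof. by case: hull. Qed.
Lemma hull_inj : injective j. Proof. by case: hull => _ []. Qed.
Lemma hull_cover v : exists m, (0 < m)%N /\ exists x, v *+ m = j x.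
Proof. by case: hull => _ [_ []]. Qed.
Lemma hull_actD g v w : dact g (v + w) = dact g v + dact g w.
Proof. by case: hull => _ [_ [_ []]]. Qed.
Lemma hull_act g x : dact g (j x) = j (act g x).
Proof. by case: hull => _ [_ [_ []]]. Qed.

Lemma hull_gaction : is_gaction dact.
Proof.
split; [exact: hull_actD|split] => [v|g h v]; have [m [m0 [x vx]]] := hull_cover v;
  apply: (rat_mulIn m0); rewrite -!(addfMn (hull_actD _)) vx !hull_act.
  by rewrite act1.
by rewrite actM.
Qed.
End Hull.

Lemma sd_mulI (G : groupType) (X : zmodType) (act : G -> X -> X) (g a b : X * G) :
  is_gaction act -> sd_mul act g a = sd_mul act g b -> a = b.
Proof.
move=> aact [] /addrI /(act_inj aact) e1 /mulgI e2.
by rewrite [a]surjective_pairing [b]surjective_pairing e1 e2.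
Qed.

Section Cocycle.
Variables (G : groupType) (X : zmodType) (act : G -> X -> X).
Variables (S : G -> Prop) (A : X -> Prop).
Variables (H : groupType) (Y : zmodType) (actt : H -> Y -> Y).
Variables (c : X * G -> X -> Y * H).
Hypotheses (st : standing_globalized act S A) (aactt : is_gaction actt).
Hypothesis cc : is_cocycle act S A actt c.
Notation constr := (constructible act S A).

Let aact := st_act st.
Let sA := st_A st.

Lemma dom_transl m x : A m -> A x -> dom_A act A (m, 1%g) x.
Proof. by move=> Am Ax; split => //; rewrite /sd_act /= act1 //; exact: zsubD. Qed.

Lemma dom_rot g : dom_A act A (0, g) 0.
Proof. by have A0 := zsub0 sA; split => //; rewrite /sd_act /= act0 // addr0. Qed.

Lemma coc g h a : dom_A act A h a -> dom_A act A g (sd_act act h a) ->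
  c (sd_mul act g h) a = sd_mul actt (c g (sd_act act h a)) (c h a).
Proof. by case: cc => h1 _ _ _; exact: h1. Qed.

Lemma coc_transl m m' x : A m -> A m' -> A x ->
  c (m + m', 1%g) x = sd_mul actt (c (m, 1%g) (m' + x)) (c (m', 1%g) x).
Proof.
move=> Am Am' Ax; have := @coc (m, 1%g) (m', 1%g) x (dom_transl Am' Ax).
rewrite /sd_mul /sd_act /= !act1 // mulg1; apply.
by apply: dom_transl => //; exact: zsubD.
Qed.

Lemma coc1 x : A x -> c (0, 1%g) x = sd_one H Y.
Proof.
move=> Ax; have A0 := zsub0 sA; apply: (@sd_mulI _ _ actt (c (0, 1%g) x)) => //.
have := coc_transl A0 A0 Ax; rewrite !add0r => {1}<-.
by rewrite /sd_mul /= act0 // addr0 mulg1; case: (c _ _).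
Qed.

Definition fib (m : X) := c (m, 1%g) 0.
Definition pi (m : X) := (fib m).2.
Definition rot (g : G) := c (0, g) 0.
Definition tau (g : G) := (rot g).2.

Lemma fib0 : fib 0 = sd_one H Y. Proof. by apply: coc1; exact: zsub0. Qed.

Lemma fib_inj m : A m -> fib m = sd_one H Y -> m = 0.
Proof.
move=> Am fm; case: cc => _ inj _ _.
by have [] := inj (m, 1%g) (dom_transl Am (zsub0 sA)) fm.
Qed.

Lemma tauM g h : tau (g * h)%g = (tau g * tau h)%g.
Proof.
have := @coc (0, g) (0, h) 0 (dom_rot h).
rewrite /sd_mul /sd_act /= act0 // act0 // !addr0 => /(_ (dom_rot g)).
by move/(congr1 snd).
Qed.

Lemma tau1 : tau 1%g = 1%g. Proof. by rewrite /tau /rot coc1 //; exact: zsub0. Qed.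

(** C is required to be a period uniformly over A, while m itself need not lie in C. Additivity of
    the fibre map needs one argument with period C and the other inside C. *)
Definition period (C : X -> Prop) (m : X) :=
  A m /\ forall x y, A x -> A y -> C (x - y) -> c (m, 1%g) x = c (m, 1%g) y.

Lemma period_sub (C D : X -> Prop) m : subs D C -> period C m -> period D m.
Proof. by move=> DC [Am pm]; split => // x y Ax Ay /DC; exact: pm. Qed.

(** By the cocycle identity c(m - m', x) = c(m, x - m') c(-m', x), and c(-m', x) is the inverse of
    c(m', x - m'); translating x and y by the same element preserves their congruence modulo C. *)
Lemma period_zsub C : constr C -> zsubgroup (period C).
Proof.
move=> cC; split; first by split=> [|x y Ax Ay _]; [exact: zsub0|rewrite !coc1].
move=> m m' [Am pm] [Am' pm']; have AN := zsubN sA Am'; split; first exact: zsubB.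
move=> x y Ax Ay Cxy.
have shift z : C (z + x - (z + y)) by rewrite opprD addrACA subrr add0r.
rewrite !coc_transl //; congr (sd_mul _ _ _).
  by apply: pm => //; apply: zsubD.
apply: (@sd_mulI _ _ actt (c (m', 1%g) (- m' + x))) => //.
rewrite [in RHS](pm' _ (- m' + y)) //; try exact: zsubD.
by rewrite -!coc_transl // subrr !coc1.
Qed.

Lemma period_exists m : A m -> exists C, constr C /\ period C m.
Proof. by move=> Am; case: cc => _ _ _ /(_ m Am) [C [cC pC]]; exists C. Qed.

Lemma period_gens (gens : seq X) : (forall x, List.In x gens -> A x) ->
  exists C, constr C /\ forall m, zgen (fun y => List.In y gens) m -> period C m.
Proof.
move=> Agens; suff [C [cC pC]] : exists C, constr C /\ forall m, List.In m gens -> period C m.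
  exists C; split => //; apply: zgen_min => //; exact: period_zsub.
elim: gens Agens => [|x gens IH] Agens.
  by exists A; split => //; exact: constr_A.
have [y iny|C [cC pC]] := IH; first by apply: Agens; right.
have [D [cD pD]] := period_exists (Agens x (or_introl erefl)).
exists (fun z => C z /\ D z); split; first exact: constrI.
move=> m [<-|inm]; first by apply: period_sub pD => z [].
by apply: period_sub (pC _ inm) => z [].
Qed.

(* c(m + m', 0) = c(m, m') c(m', 0), and c(m, m') = c(m, 0) as m' lies in the
   period C of m. *)
Lemma fibD C m m' : constr C -> period C m -> C m' ->
  fib (m + m') = sd_mul actt (fib m) (fib m').
Proof.
move=> cC [Am pm] Cm'; have Am' := constr_sub st cC Cm'; have A0 := zsub0 sA.
rewrite /fib coc_transl // addr0 (pm m' 0) ?subr0 //.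
Qed.

Lemma piD C m m' : constr C -> period C m -> C m' -> pi (m + m') = (pi m * pi m')%g.
Proof. by move=> cC pm Cm'; rewrite /pi (fibD cC pm Cm'). Qed.

Lemma pi0 : pi 0 = 1%g. Proof. by rewrite /pi fib0. Qed.

Lemma piMn C m n : constr C -> period C m -> C m -> pi (m *+ n) = (pi m ^+ n)%g.
Proof.
move=> cC pm Cm; elim: n => [|n IHn]; first by rewrite mulr0n pi0 expg0.
rewrite mulrS (piD cC pm) ?IHn ?expgS //.
by apply: zsubMn => //; exact: constr_zsub cC.
Qed.

Lemma fibMn C m n y : constr C -> period C m -> C m -> fib m = (y, 1%g) ->
  fib (m *+ n) = (y *+ n, 1%g).
Proof.
move=> cC pm Cm fm; elim: n => [|n IHn]; first by rewrite !mulr0n fib0.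
rewrite mulrS (fibD cC pm) ?IHn ?fm /sd_mul /= ?act1 ?mulg1 ?mulrS //.
by apply: zsubMn => //; exact: constr_zsub cC.
Qed.

Lemma piN C m : constr C -> period C m -> C m -> pi (- m) = (pi m)^-1%g.
Proof.
move=> cC pm Cm; apply/esym/mulg1_eq; rewrite -(piD cC pm) ?subrr ?pi0 //.
by apply: zsubN => //; exact: constr_zsub cC.
Qed.

Lemma piMz C m z : constr C -> period C m -> C m -> pi (m *~ z) = zpowg (pi m) z.
Proof.
move=> cC pm Cm; case: z => n; first exact: (piMn _ cC).
have sC := constr_zsub st cC; have sP := period_zsub cC.
rewrite NegzE mulrNz -pmulrn (piN cC) ?(piMn _ cC) //; exact: zsubMn.
Qed.

Lemma pi_commute C m m' : constr C -> period C m -> C m -> period C m' -> C m' ->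
  commute (pi m) (pi m').
Proof. by move=> cC pm Cm pm' Cm'; rewrite /commute -!(piD cC) // addrC. Qed.

(** The products (g.m, 1)(0, g) and (0, g)(m, 1) agree; evaluate c at 0 on both. Local constancy of
    c((0, g), .) at 0 replaces c((0, g), m) by its value at 0 for m in C. *)
Lemma fib_rot g : exists C, constr C /\ forall m, C m -> A (act g m) ->
  sd_mul actt (fib (act g m)) (rot g) = sd_mul actt (rot g) (fib m).
Proof.
case: (cc) => _ _ loc _; have A0 := zsub0 sA.
have [C [cC CP]] := loc (0, g) 0 (dom_rot g); exists C; split => // m Cm Agm.
have Am := constr_sub st cC Cm.
have dm : dom_A act A (0, g) m by split => //; rewrite /sd_act /= add0r.
have := @coc (act g m, 1%g) (0, g) 0 (dom_rot g).
rewrite /sd_act /= act0 // addr0 => /(_ (dom_transl Agm A0)) <-.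
have := @coc (0, g) (m, 1%g) 0 (dom_transl Am A0).
rewrite {1 2}/sd_act /= act1 // addr0 => /(_ dm).
rewrite (CP m dm) ?subr0 // => <-; congr (c _ _).
by rewrite /sd_mul /= act1 // add0r addr0 mul1g mulg1.
Qed.

Lemma pi_rot g : exists C, constr C /\ forall m, C m -> A (act g m) ->
  pi (act g m) = (tau g * pi m * (tau g)^-1)%g.
Proof.
have [C [cC CP]] := fib_rot g; exists C; split => // m Cm Agm.
by have /(congr1 snd) /= := CP m Cm Agm; rewrite -/(pi _) -/(tau _) => <-; rewrite mulgK.
Qed.

(** All multiples of N are included so that N may later be replaced by a common multiple. *)
Definition ev_trivial (a : X) := exists N, (0 < N)%N /\ forall n, pi (a *+ (N * n)) = 1%g.

Lemma ev_trivial_intro C a N : constr C -> period C a -> (0 < N)%N -> C (a *+ N) ->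
  finite_order (pi (a *+ N)) -> ev_trivial a.
Proof.
move=> cC pa N0 CN [l [l0 pl]]; exists (N * l)%N; rewrite muln_gt0 N0; split => // n.
rewrite -mulnA mulrnA (piMn _ cC) //; last exact: zsubMn (period_zsub cC) _ _ _.
by rewrite expgnA pl expg1n.
Qed.

Lemma common_multiple (ms : seq X) (C : X -> Prop) : constr C ->
  (forall x, List.In x ms -> A x) ->
  exists N, (0 < N)%N /\ forall x, List.In x ms -> C (x *+ N).
Proof.
move=> cC; have sC := constr_zsub st cC; elim: ms => [|m ms IH] Ams; first by exists 1%N.
have [x inx|N [N0 NP]] := IH; first by apply: Ams; right.
have [N' [N0' CN']] := constr_mult st cC (Ams m (or_introl erefl)).
exists (N * N')%N; rewrite muln_gt0 N0; split => // x [<-|/NP].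
  by rewrite mulnC mulrnA; exact: zsubMn.
by rewrite mulrnA; exact: zsubMn.
Qed.

(** On suitable multiples in C, pi(sigma_s m) is the conjugate of pi(m) by tau(s), and it commutes
    with pi(m) because A is abelian. So tau(s) commutes with pi(m), the two values agree, and pi is
    trivial on multiples of m - sigma_s(m). *)
Lemma ev_trivial_coboundary s a m n : two_gen_free_or_abelian H -> S s ->
  A a -> A m -> (0 < n)%N -> a *+ n = m - act s m -> ev_trivial a.
Proof.
move=> two Ss Aa Am n0 am; have Asm := st_actA st Ss Am.
have [C1 [cC1 p1]] := @period_gens [:: a; m; act s m] ltac:(by move=> x [<-|[<-|[<-|[]]]]).
have gen x : List.In x [:: a; m; act s m] -> period C1 x by move=> inx; apply: p1 => M sM; apply.
have [C2 [cC2 rotP]] := pi_rot s.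
pose C x := C1 x /\ C2 x; have cC : constr C by exact: constrI.
have sC := constr_zsub st cC; have sP := period_zsub cC.
have pC x : List.In x [:: a; m; act s m] -> period C x.
  by move=> /gen; apply: period_sub => z [].
have [N [N0 NP]] := @common_multiple [:: a; m; act s m] C cC
  ltac:(by move=> x [<-|[<-|[<-|[]]]]).
have CaN : C (a *+ N) by apply: NP; left.
have CmN : C (m *+ N) by apply: NP; right; left.
have CsN : C (act s m *+ N) by apply: NP; right; right; left.
have pa : period C a by apply: pC; left.
have pm : period C m by apply: pC; right; left.
have ps : period C (act s m) by apply: pC; right; right; left.
have conjE : pi (act s m *+ N) = (tau s * pi (m *+ N) * (tau s)^-1)%g.
  by rewrite -actMn // rotP; [|case: CmN|rewrite actMn //; exact: zsubMn].
have com : commute (pi (m *+ N)) (tau s).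
  apply: two_gen_conj_commute => //; rewrite -conjE.
  by apply: (pi_commute cC) => //; exact: zsubMn.
have fixE : pi (act s m *+ N) = pi (m *+ N).
  by rewrite conjE -com mulgK.
have CanN : C (a *+ (n * N)) by rewrite mulnC mulrnA; exact: zsubMn.
apply: (@ev_trivial_intro C a (n * N)) => //; first by rewrite muln_gt0 n0.
exists 1%N; split => //; rewrite expg1.
have : pi (a *+ (n * N) + act s m *+ N) = pi (m *+ N).
  by rewrite mulrnA am mulrnBl subrK.
rewrite (piD cC) //; last exact: zsubMn.
by rewrite fixE => e; apply: (mulIg (pi (m *+ N))); rewrite mul1g.
Qed.

(** For a multiple m of a in C, pi(kappa m) is both pi(m)^kappa and the conjugate of pi(m) by
    tau(s). *)
Lemma ev_trivial_scalar s kappa a : S s -> (forall a, A a -> act s a = a *~ kappa) ->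
  (forall alpha, zpowg alpha kappa = (tau s * alpha * (tau s)^-1)%g -> finite_order alpha) ->
  A a -> ev_trivial a.
Proof.
move=> Ss sk fo Aa; have [C1 [cC1 pa1]] := period_exists Aa.
have [C2 [cC2 rotP]] := pi_rot s.
pose C x := C1 x /\ C2 x; have cC : constr C by exact: constrI.
have sC := constr_zsub st cC; have sP := period_zsub cC.
have pa : period C a by apply: period_sub pa1 => z [].
have [N [N0 CN]] := constr_mult st cC Aa.
apply: (@ev_trivial_intro C a N) => //; apply: fo.
have AN := zsubMn sA N Aa.
rewrite -rotP; [|by case: CN|exact: (st_actA st Ss AN)].
by rewrite sk // (piMz _ cC) //; exact: zsubMn.
Qed.

Hypothesis tfX : torsion_free_on (fun _ : X => True).

Lemma tf_sub (M : X -> Prop) : torsion_free_on M.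
Proof. by move=> x m _; exact: tfX. Qed.

(** Under (i_1), id - sigma_s is injective on a subgroup of finite rank, so its image contains a
    positive multiple of a: up to a multiple, every a is a coboundary. *)
Lemma cond_I_seq_ev_trivial Ms a : good_seq A Ms -> cond_I_seq act S A H Ms -> A a ->
  ev_trivial a.
Proof.
move=> [MsP [_ Acov]] [i1|[kappa [[k0 [k1 [s [Ss sk]]]] fo]]] Aa; last first.
  apply: (ev_trivial_scalar Ss sk) => // alpha E; apply: fo; exists (tau s)^-1%g.
  by rewrite E /conjg invgK mulgA.
have [n Ma] := (Acov a).1 Aa; have [[s [Ss [sM inj]]] two] := i1 n.
have [sMs fr] := MsP n.
have [|||m [m0 /(_ a Ma) [b [Mb ab]]]] :=
    @injective_endo_index X (Ms n) (fun x => x - act s x) (tf_sub (M := _)) sMs fr.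
- by move=> x y; rewrite actD // opprD addrACA.
- by move=> x Mx; apply: zsubB => //; apply: sM; exists x.
- move=> x Mx x0; apply: inj => //; first exact: zsub0.
  by rewrite x0 act0 // subrr.
by apply: (ev_trivial_coboundary two Ss Aa _ m0 ab); apply/Acov; exists n.
Qed.

End Cocycle.

Lemma expg_coprime1 (G : groupType) (x : G) m n :
  coprime m n -> (x ^+ m = 1)%g -> (x ^+ n = 1)%g -> x = 1%g.
Proof.
case: m => [|m].
  by rewrite /coprime gcd0n => /eqP -> _; rewrite expg1.
move=> cop xm xn; case: (egcdnP n (ltn0Sn m)) => u v /= uv _.
have := congr1 (fun l => (x ^+ l)%g) uv; rewrite (eqP cop).
by rewrite mulnC expgnA xm expg1n addn1 expgSr mulnC expgnA xn expg1n mul1g => /esym.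
Qed.

Lemma prime_has_order (G : groupType) (x : G) p :
  prime p -> (x ^+ p = 1)%g -> x <> 1%g -> has_order x p.
Proof.
move=> pp xp x1; split; first exact: prime_gt0.
split=> // k k0 kp xk; apply: x1; apply: (@expg_coprime1 _ _ p k) => //.
by rewrite prime_coprime // gtnNdvd.
Qed.

Lemma act_iter (G : groupType) (X : zmodType) (act : G -> X -> X) g n x :
  is_gaction act -> act (g ^+ n)%g x = iter n (act g) x.
Proof.
by move=> aact; elim: n => [|n IHn]; rewrite ?expg0 ?act1 // expgS actM // IHn.
Qed.

Lemma conj_expg (G : groupType) (x y : G) n :
  ((y * x * y^-1) ^+ n = y * x ^+ n * y^-1)%g.
Proof.
elim: n => [|n IHn]; first by rewrite !expg0 mulg1 mulgV.
by rewrite !expgS IHn !mulgA mulgVK.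
Qed.

(** * Elements conjugate to their powers under (F) in finite rank *)

Section ScalarCase.
Variables (H : groupType) (Y : zmodType) (actt : H -> Y -> Y).
Variables (T : H -> Prop) (B : Y -> Prop).
Variables (W : lmodType rat) (k : Y -> W) (dactt : H -> W -> W).
Hypotheses (stt : standing_globalized actt T B) (hull : rational_hull actt k dactt).
Hypotheses (fr : finite_rank (fun _ : Y => True)) (condF : cond_F actt).

Lemma cond_F_fixed (t : H) y : actt t y = y -> y <> 0 -> t = 1%g.
Proof.
move=> ty y0; apply: contrapT => t1; apply: y0; apply: (condF t1).
by rewrite ty (act0 (st_act stt)) !subrr.
Qed.

Lemma conj_power_finite_order (alpha beta : H) q : (1 < q)%N ->
  (alpha ^+ q)%g = (beta * alpha * beta^-1)%g -> finite_order alpha.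
Proof.
move=> q1 conjE; have aact := st_act stt; have daact := hull_gaction aact hull.
have [d [dec [enc cW]]] := hull_coordinates hull fr; have [decD dK eK] := cW.
case: d dec enc cW decD dK eK => [|d] dec enc cW decD dK eK.
  exists 1%N; split => //; rewrite expg1; apply: (st_JF stt) => y _.
  apply: (hull_inj hull); rewrite -[LHS]eK -[RHS]eK; congr dec.
  by apply/rowP => -[].
have /choice[P PP] h : exists P : 'M[rat]_d.+1,
    row_free P /\ forall u, enc (dactt h (dec u)) = u *m P.
  apply: (injective_row_free cW cW (hull_actD hull h)); exact: act_inj.
(* Row vectors reverse products, which is why the intertwiner below is the matrix of beta^-1. *)
have PM g h : P (g * h)%g = P h *m P g.
  apply/row_matrixP => i; rewrite !rowE mulmxA -!(PP _).2 eK.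
  by rewrite (actM daact).
have P1 : P 1%g = 1%:M.
  by apply/row_matrixP => i; rewrite !rowE -(PP _).2 (act1 daact) dK mulmx1.
have PX h n : P (h ^+ n)%g = P h ^+ n.
  by elim: n => [|n IHn]; rewrite ?expg0 ?expr0 // expgS PM IHn exprSr.
have Pu h : P h \in unitmx by rewrite -row_free_unit; exact: (PP h).1.
have [|r [u [r0 u0 uP]]] := @conj_power_fixed_vector d (P alpha) (P beta^-1%g) q q1 (Pu _) (Pu _).
  by rewrite -PX -!PM conjE !mulgA mulVg mul1g.
exists r; split => //.
have [n [n0 [y yE]]] := hull_cover hull (dec u).
apply: (@cond_F_fixed _ y).
  apply: (hull_inj hull); rewrite -(hull_act hull) -yE (actMn daact); congr (_ *+ _).
  by apply: (can_inj eK); rewrite (PP _).2 PX uP dK.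
move=> y0; case/eqP: u0; apply: (can_inj dK); apply: (rat_mulIn n0).
by rewrite yE y0 (addf0 (hullD hull)) (addf0 decD) mul0rn.
Qed.

(* For kappa = -1 the element beta is an involution; by (F) it then acts as
   -1 and is central in the image. *)
Lemma conj_zpow_finite_order (alpha beta : H) kappa : kappa <> 0 -> kappa <> 1 ->
  (kappa = -1 -> (beta * beta)%g = 1%g) ->
  zpowg alpha kappa = (beta * alpha * beta^-1)%g -> finite_order alpha.
Proof.
have aact := st_act stt.
case: kappa => [[|[|n]]|[|n]] // _ _ inv; first exact: conj_power_finite_order.
  move=> /= conjE; have bb := inv erefl.
  have [b1|b1] := pselect (beta = 1%g).
    exists 2%N; split=> //; move: conjE; rewrite b1 invg1 mulg1 mul1g expg1 => aV.
    by rewrite expg2 -{1}aV mulVg.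
  (* The vector y + beta y is fixed by the involution beta, hence zero by (F). *)
  have bN y : actt beta y = - y.
    apply/eqP; rewrite -addr_eq0 addrC; apply/eqP; apply: contrapT => y0; apply: b1.
    by apply: cond_F_fixed y0; rewrite (actD aact) -(actM aact) bb (act1 aact) addrC.
  exists 2%N; split => //; apply: (st_JF stt) => y _.
  rewrite expg2 (actM aact).
  have aV z : actt alpha^-1%g z = actt alpha z.
    rewrite -[alpha in LHS]expg1 conjE !(actM aact).
    have -> : beta^-1%g = beta by exact: mulg1_eq.
    by rewrite !bN (actN aact) opprK.
  by rewrite -aV actK.
(* For kappa <= -2, applying the relation twice gives the positive exponent kappa^2, with beta^2 as
   conjugator. *)
move=> /= conjE; apply: (@conj_power_finite_order _ (beta * beta)%g (n.+2 * n.+2)%N) => //.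
have -> : (alpha ^+ (n.+2 * n.+2))%g = (((alpha ^+ n.+2)^-1) ^+ n.+2)^-1%g.
  by rewrite expVgn invgK expgnA.
rewrite conjE conj_expg; move: (alpha ^+ n.+2)%g conjE => x conjE.
by rewrite !invgM invgK conjE !mulgA.
Qed.

End ScalarCase.

(** * Vanishing of the group component of the fibre map *)

Section TrivialComponent.
Variables (G : groupType) (X : zmodType) (act : G -> X -> X).
Variables (S : G -> Prop) (A : X -> Prop).
Variables (H : groupType) (Y : zmodType) (actt : H -> Y -> Y).
Variables (T : H -> Prop) (B : Y -> Prop).
Variables (c : X * G -> X -> Y * H).
Hypotheses (st : standing_globalized act S A) (stt : standing_globalized actt T B).
Hypothesis cc : is_cocycle act S A actt c.
Hypotheses (tfX : torsion_free_on (fun _ : X => True)).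
Variables (W : lmodType rat) (k : Y -> W) (dactt : H -> W -> W).
Hypothesis hullY : rational_hull actt k dactt.
Notation constr := (constructible act S A).
Notation pi := (pi c).
Notation fib := (fib c).
Notation tau := (tau c).
Notation period := (period A c).

Let aact := st_act st.
Let sA := st_A st.
Let aactt := st_act stt.

Lemma cond_III_ev_trivial a : cond_III act S A actt -> A a -> ev_trivial c a.
Proof.
move=> [[kappa [k0 [k1 [s [Ss sk]]]]] [fr F]] Aa.
apply: (ev_trivial_scalar st aactt cc Ss sk) => // alpha E.
apply: (conj_zpow_finite_order stt hullY fr F k0 k1 _ E) => kN.
(* If kappa = -1, then sigma_s squared is the identity, so s has square 1 by faithfulness and tau(s)
   is an involution. *)
rewrite -(tauM st cc) -(tau1 st aactt cc); congr tau.
apply: (st_faithful st); [exact: (st_SM st)|exact: (st_S1 st)|] => b Ab.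
by rewrite (actM aact) (act1 aact) !sk // ?kN ?mulrN1z ?opprK //; exact: zsubN.
Qed.

Lemma ev_trivial_finite_order C m : constr C -> period C m -> C m -> ev_trivial c m ->
  finite_order (pi m).
Proof.
move=> cC pm Cm [N [N0 NP]]; exists N; split => //.
by rewrite -(piMn st aactt cc _ cC) // -[N]muln1.
Qed.

(** If pi(m)^l = 1, then fib(l m) = (y, 1). Commuting it with fib(m) shows that pi(m) fixes y, so
    (F) applies unless y = 0; in that case l m = 0 by injectivity, and m = 0. *)
Lemma cond_F_torsion C m : cond_F actt -> constr C -> period C m -> C m ->
  finite_order (pi m) -> pi m = 1%g.
Proof.
move=> F cC pm Cm [l [l0 pl]]; apply: contrapT => p1; apply: p1.
have sC := constr_zsub st cC; have sP := period_zsub st aactt cc cC.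
have pil : pi (m *+ l) = 1%g by rewrite (piMn st aactt cc _ cC).
have fE : fib (m *+ l) = ((fib (m *+ l)).1, 1%g).
  by rewrite -pil; exact: surjective_pairing.
have Cl : C (m *+ l) by exact: zsubMn.
have ppl : period C (m *+ l) by exact: zsubMn.
have := fibD st cc cC pm Cl; rewrite addrC (fibD st cc cC ppl Cm) fE /sd_mul /=.
move=> [] /eqP; rewrite (act1 aactt) addrC (inj_eq (addrI _)) => /eqP fixz _.
have [p1|p1] := pselect (pi m = 1%g); first by [].
have z0 : (fib (m *+ l)).1 = 0.
  apply: contrapT => z0; apply: p1; exact: (cond_F_fixed stt F (esym fixz) z0).
have ml0 : m *+ l = 0.
  by apply: (fib_inj st cc) => //; [exact: (constr_sub st cC)|rewrite fE z0].
have m0 : m = 0 by exact: (tfX I l0 ml0).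
by rewrite m0 (pi0 st aactt cc).
Qed.

(* Induction on an exponent e killing pi on F /\ D for small D.  For a prime
   p | e which is the order of an element of the target group, (ii_1) gives u
   with mu sigma_u = nu where p divides exactly one of mu, nu; conjugating by u
   then shows that e / p also works after shrinking D. *)
Lemma cond_ii1_trivial M F gens C : zsubgroup M -> cond_ii1 act S H M ->
  (forall x, F x <-> zgen (fun y => List.In y gens) x) -> subs F M -> subs F A ->
  (forall s, S s -> subs (img act s F) F) -> (forall a, A a -> ev_trivial c a) ->
  constr C -> (forall m, F m -> period C m) ->
  exists D, [/\ constr D, subs D C & forall m, F m -> D m -> pi m = 1%g].
Proof.
move=> sM ii1 FE FM FA FS ev cC pF.
have sC := constr_zsub st cC; have sP := period_zsub st aactt cc cC.
have sF : zsubgroup F.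
  have [g0 gB] := zgen_zsubgroup (fun y => List.In y gens).
  by split=> [|x y /FE Fx /FE Fy]; apply/FE => //; exact: gB.
have Fgen x : List.In x gens -> F x by move=> inx; apply/FE => K sK; apply.
pose Q e := exists D, [/\ constr D, subs D C & forall m, F m -> D m -> (pi m ^+ e)%g = 1%g].
(* N brings F into C, where pi is multiplicative with commuting values, and L kills the images of
   the finitely many generators; e = N L. *)
have [e [e0 Qe]] : exists e, (0 < e)%N /\ Q e.
  have [N [N0 NP]] := common_multiple st cC (fun x inx => FA _ (Fgen x inx)).
  have FN x : F x -> C (x *+ N).
    move=> /FE; apply: (@zgen_min _ _ (fun x => C (x *+ N))) => //.
    split; first by rewrite mul0rn; exact: zsub0.
    by move=> y z Cy Cz; rewrite mulrnBl; exact: zsubB.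
  have [L [L0 LP]] : exists L, (0 < L)%N /\ forall x, List.In x gens ->
      (pi (x *+ N) ^+ L)%g = 1%g.
    have : forall x, List.In x gens -> F x by [].
    elim: (gens) => [|x l IH] Fl; first by exists 1%N.
    have [y iny|L [L0 LP]] := IH; first by apply: Fl; right.
    have Fx := Fl x (or_introl erefl).
    have [||n [n0 nP]] := @ev_trivial_finite_order C (x *+ N) cC _ (FN x Fx) _.
    - by apply: pF; exact: zsubMn.
    - by apply/ev/FA; exact: zsubMn.
    exists (L * n)%N; rewrite muln_gt0 L0; split => // y [<-|iny].
      by rewrite mulnC expgnA nP expg1n.
    by rewrite expgnA LP // expg1n.
  exists (N * L)%N; rewrite muln_gt0 N0; split => //; exists C; split => // m Fm Cm.
  rewrite expgnA -(piMn st aactt cc _ cC) //; last exact: pF.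
  suff [] : F m /\ (pi (m *+ N) ^+ L)%g = 1%g by [].
  move: (Fm) => /FE; apply: (@zgen_min _ _ (fun m => F m /\ (pi (m *+ N) ^+ L)%g = 1%g)).
    split; first by rewrite mul0rn (pi0 st aactt cc) expg1n; split => //; exact: zsub0.
    move=> x y [Fx px] [Fy py]; split; first exact: zsubB.
    have pN z : F z -> period C (z *+ N) by move=> Fz; apply: pF; exact: zsubMn.
    have com := pi_commute st cc cC (pN x Fx) (FN x Fx) (pN y Fy) (FN y Fy).
    rewrite mulrnBl (piD st cc cC (pN x Fx)); last by apply: zsubN => //; exact: FN.
    rewrite (piN st aactt cc cC (pN y Fy) (FN y Fy)) expgMn; last exact: commuteV.
    by rewrite px expVgn py invg1 mulg1.
  by move=> x inx; split; [exact: Fgen|exact: LP].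
suff : Q 1%N by [].
have [n] := ubnP e; elim: n e e0 Qe => // n IHn e e0 [D [cD DC DP]]; rewrite ltnS => en.
have [e1|e1] := leqP e 1.
  exists D; split => // m Fm Dm; rewrite -(DP m Fm Dm); congr (_ ^+ _)%g.
  by apply/eqP; rewrite eqn_leq e1 e0.
have pp := pdiv_prime e1; set p := pdiv e in pp; set e' := (e %/ p)%N.
have ee' : e = (e' * p)%N by rewrite divnK // pdiv_dvd.
have e'0 : (0 < e')%N by move: e0; rewrite ee' muln_gt0 => /andP [].
apply: (IHn e') => //; last first.
  by apply: leq_trans en; rewrite ltn_Pdiv // prime_gt1.
have pow_p m : F m -> D m -> ((pi m ^+ e') ^+ p)%g = 1%g.
  by move=> Fm Dm; rewrite -expgnA -ee'; exact: DP.
have [[alpha ord]|noord] := pselect (exists alpha : H, has_order alpha p); last first.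
  exists D; split => // m Fm Dm; apply: contrapT => ne; apply: noord.
  by exists (pi m ^+ e')%g; apply: prime_has_order => //; exact: pow_p.
have [s [Ss [_ [mu [nu [mu0 [nu0 [cop [sMM [[q [delta [qP qE]]] gc]]]]]]]]]] :=
  ii1 p (prime_gt1 pp) (ex_intro _ alpha ord).
pose u := (s ^+ delta)%g; have Su : S u by exact: (st_SX st).
have uE x : M x -> act u x *+ mu = x *+ nu.
  move=> Mx; rewrite (act_iter _ _ _ aact).
  apply: (charpoly_power (tf_sub tfX (M := M)) sM (actD aact s) _ qP qE Mx).
  by move=> y My; apply: sMM; exists y.
have [E [cE EP]] := pi_rot st cc u.
(* E makes conjugation by tau(u) available, and the preimage condition puts sigma_u(m) into D, hence
   into C, where pi of a multiple is a power. *)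
pose D1 x := D x /\ E x; have cD1 : constr D1 by exact: constrI.
pose D' x := D1 x /\ preimg act A u D x.
have cD' : constr D' by apply: constrI => //; exact: constr_pre.
exists D'; split => //; first by move=> x [[/DC]].
move=> m Fm [[Dm Em] [Am Dum]].
have Fum : F (act u m) by apply: FS Su _ _; exists m.
set b := (pi m ^+ e')%g; have bp : (b ^+ p)%g = 1%g by exact: pow_p.
(* Both sides equal the e'-th power of pi(mu sigma_u(m)) = pi(nu m). *)
have rel : (tau u * b ^+ mu * (tau u)^-1)%g = (b ^+ nu)%g.
  rewrite /b -!expgnA mulnC [(e' * nu)%N]mulnC !expgnA -!conj_expg.
  rewrite -EP //; last exact: (constr_sub st cD).
  rewrite -(piMn st aactt cc _ cC (pF _ Fum) (DC _ Dum)) uE; last exact: FM.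
  by rewrite (piMn st aactt cc _ cC (pF _ Fm) (DC _ Dm)).
have dvd_exp n' : (p %| n')%N -> (b ^+ n')%g = 1%g.
  by move=> /dvdnP [r ->]; rewrite mulnC expgnA bp expg1n.
have dvd_of l : (1 < gcdn p l)%N -> (p %| l)%N.
  move=> g1; rewrite -[(_ %| _)%N]negbK -prime_coprime // /coprime.
  by apply/negP => /eqP g; rewrite g in g1.
have [/dvd_of pmu|/dvd_of pnu] := gc.
  have bnu : (b ^+ nu)%g = 1%g by rewrite -rel (dvd_exp _ pmu) mulg1 mulgV.
  apply: expg_coprime1 bp bnu; rewrite prime_coprime //; apply/negP => pnu.
  by have := dvdn_gcd p mu nu; rewrite pmu pnu (eqP cop) dvdn1 => /eqP pe; rewrite pe in pp.
have bmu : (b ^+ mu)%g = 1%g.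
  move: rel; rewrite (dvd_exp _ pnu) => /(congr1 (fun h => (tau u)^-1 * h * tau u)%g).
  by rewrite !mulgA mulVg mul1g mulgVK mulg1 mulVg.
apply: expg_coprime1 bp bmu; rewrite prime_coprime //; apply/negP => pmu.
by have := dvdn_gcd p mu nu; rewrite pmu pnu (eqP cop) dvdn1 => /eqP pe; rewrite pe in pp.
Qed.

Lemma cond_star_ev_trivial a : cond_star act S A actt T B -> A a -> ev_trivial c a.
Proof.
move=> [[Ms [gs [[I1 _]|III]]] _] Aa; last exact: cond_III_ev_trivial.
exact: (cond_I_seq_ev_trivial st aactt cc tfX gs I1).
Qed.

Lemma cond_star_small a : cond_star act S A actt T B -> A a ->
  exists s C, [/\ S s, constr C, period C (act s a), C (act s a) & pi (act s a) = 1%g].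
Proof.
move=> star Aa; have ev b : A b -> ev_trivial c b by exact: cond_star_ev_trivial.
case: (star) => -[Ms [[MsP [Msinc Mscov]] alt]] [[Fs [Fgen [Finc [Fcov FS]]]]].
case=> _ [_ [_ [_ [_ [_ PC]]]]].
have [l Fa] := (Fcov a).1 Aa; have [gens FE] := Fgen l; set F := Fs l in Fa FE.
have FA : subs F A by move=> x Fx; apply/Fcov; exists l.
have gensF x : List.In x gens -> F x by move=> inx; apply/FE => K sK; apply.
have [C [cC pC]] := period_gens st aactt cc (fun x inx => FA _ (gensF x inx)).
have pF m : F m -> period C m by move=> /FE; exact: pC.
have [D [cD DC DP]] : exists D, [/\ constr D, subs D C & forall m, F m -> D m -> pi m = 1%g].
  have viaF : cond_F actt -> exists D,
      [/\ constr D, subs D C & forall m, F m -> D m -> pi m = 1%g].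
    move=> condF; exists C; split => // m Fm Cm.
    apply: (cond_F_torsion condF cC (pF m Fm) Cm).
    apply: (ev_trivial_finite_order cC (pF m Fm) Cm); exact/ev/FA.
  case: alt => [[_ [ii1|[/viaF //]]]|[_ [_ /viaF //]]].
  (* The condition (ii_1) is given for each M_n; a finitely generated F lies in one of them. *)
  have [n FM] : exists n, subs F (Ms n).
    have Ms_le i j : (i <= j)%N -> subs (Ms i) (Ms j).
      move=> /subnK <-; elim: (j - i)%N => [//|d IH] x Mx.
      by rewrite addSn; apply: Msinc; exact: IH.
    suff [n nP] : exists n, forall x, List.In x gens -> Ms n x.
      by exists n => x /FE; apply: zgen_min => //; exact: (MsP n).1.
    elim: (gens) gensF => [|x g IH] Fg; first by exists 0%N.
    have [y iny|n nP] := IH; first by apply: Fg; right.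
    have [n' xn'] := (Mscov x).1 (FA _ (Fg x (or_introl erefl))).
    exists (n + n')%N => y [<-|/nP]; last by apply: Ms_le; exact: leq_addr.
    by apply: Ms_le xn'; exact: leq_addl.
  apply: (cond_ii1_trivial (MsP n).1 (ii1 n) FE FM FA _ ev cC pF).
  by move=> s Ss; exact: FS.
have [s [Ss sD]] := PC D cD; exists s, C.
have Fsa : F (act s a) by apply: (FS s l Ss); exists a.
by split => //; [exact: pF|exact/DC/sD|apply: DP => //; exact: sD].
Qed.

End TrivialComponent.

(** * The embeddings *)

Section Embedding.
Variables (G : groupType) (X : zmodType) (act : G -> X -> X).
Variables (S : G -> Prop) (A : X -> Prop).
Variables (H : groupType) (Y : zmodType) (actt : H -> Y -> Y).
Variables (T : H -> Prop) (B : Y -> Prop).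
Variables (c : X * G -> X -> Y * H).
Hypotheses (st : standing_globalized act S A) (stt : standing_globalized actt T B).
Hypothesis cc : is_cocycle act S A actt c.
Hypotheses (tfX : torsion_free_on (fun _ : X => True)).
Variables (V : lmodType rat) (j : X -> V) (dact : G -> V -> V).
Variables (W : lmodType rat) (k : Y -> W) (dactt : H -> W -> W).
Hypotheses (hullX : rational_hull act j dact) (hullY : rational_hull actt k dactt).
Notation constr := (constructible act S A).
Notation pi := (pi c).
Notation fib := (fib c).
Notation tau := (tau c).
Notation period := (period A c).

Let aact := st_act st.
Let sA := st_A st.
Let aactt := st_act stt.
Let daact := hull_gaction aact hullX.
Let daactt := hull_gaction aactt hullY.
Let jD := hullD hullX.
Let kD := hullD hullY.

(* The value (1/N) c(N a, 0) in Q (x) BB is the same for all sufficiently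
   divisible N; [w] is this value. *)
Definition limit_value (a : X) (w : W) := exists N, (0 < N)%N /\
  forall n, exists y, fib (a *+ (N * n)) = (y, 1%g) /\ w *+ (N * n) = k y.

Lemma limit_value_fun a w w' : limit_value a w -> limit_value a w' -> w = w'.
Proof.
move=> [N [N0 NP]] [N' [N0' NP']].
have NN0 : (0 < N * N')%N by rewrite muln_gt0 N0.
apply: (rat_mulIn NN0).
have [y [fy ->]] := NP N'; have [y' [fy' wy']] := NP' N.
by rewrite mulnC wy'; move: fy; rewrite mulnC fy' => -[->].
Qed.

Lemma limit_value_of_fib C a N y : constr C -> period C a -> (0 < N)%N -> C (a *+ N) ->
  fib (a *+ N) = (y, 1%g) -> limit_value a (N%:R^-1 *: k y).
Proof.
move=> cC pa N0 CN fy; exists N; split => // n; exists (y *+ n); split.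
  rewrite mulrnA (fibMn st aactt cc _ cC _ CN fy) //.
  by apply: zsubMn => //; exact: (period_zsub st aactt cc cC).
rewrite mulrnA -[_ *: _ *+ N]scaler_nat scalerA mulfV ?scale1r ?(addfMn kD) //.
by rewrite pnatr_eq0 -lt0n.
Qed.

Lemma limit_value_total a : A a -> ev_trivial c a -> exists w, limit_value a w.
Proof.
move=> Aa [N [N0 NP]]; have [C [cC pa]] := period_exists cc Aa.
have [N' [N0' CN']] := constr_mult st cC Aa.
have [y fy] : exists y, fib (a *+ (N * N')) = (y, 1%g).
  by exists (fib (a *+ (N * N'))).1; rewrite -(NP N'); exact: surjective_pairing.
exists ((N * N')%:R^-1 *: k y); apply: (limit_value_of_fib cC pa _ _ fy).
  by rewrite muln_gt0 N0.
by rewrite mulnC mulrnA; apply: zsubMn => //; exact: (constr_zsub st cC).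
Qed.

Lemma limit_valueD a a' w w' : A a -> A a' -> limit_value a w -> limit_value a' w' ->
  limit_value (a + a') (w + w').
Proof.
move=> Aa Aa' [N [N0 NP]] [N' [N0' NP']].
have [C [cC pa]] := period_exists cc Aa; have sC := constr_zsub st cC.
have [M [M0 CM]] := constr_mult st cC Aa'.
exists (N * N' * M)%N; rewrite !muln_gt0 N0 N0' M0; split => // n.
have [y [fy wy]] := NP (N' * M * n)%N; have [y' [fy' wy']] := NP' (N * M * n)%N.
have e1 : (N * (N' * M * n) = N * N' * M * n)%N by rewrite !mulnA.
have e2 : (N' * (N * M * n) = N * N' * M * n)%N by rewrite !mulnA [(N' * N)%N]mulnC.
rewrite e1 in fy wy; rewrite e2 in fy' wy'.
exists (y + y'); rewrite !mulrnDl wy wy' kD; split => //.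
rewrite (fibD st cc cC) ?fy ?fy' /sd_mul /= ?(act1 aactt) ?mulg1 //.
  by apply: zsubMn => //; exact: (period_zsub st aactt cc cC).
have -> : (N * N' * M * n = M * (N * N' * n))%N by lia.
by rewrite mulrnA; exact: zsubMn.
Qed.

Lemma limit_value0 : limit_value 0 0.
Proof.
exists 1%N; split => // n; exists 0.
by rewrite !mul0rn (fib0 st aactt cc) (addf0 kD).
Qed.

Lemma limit_valueMn a w n : A a -> limit_value a w -> limit_value (a *+ n) (w *+ n).
Proof.
move=> Aa aw; elim: n => [|n IHn]; first by rewrite !mulr0n; exact: limit_value0.
by rewrite !mulrS; apply: limit_valueD => //; exact: zsubMn.
Qed.

Lemma limit_value_inj a : A a -> limit_value a 0 -> a = 0.
Proof.
move=> Aa [N [N0 /(_ 1%N)]]; rewrite muln1 mul0rn => -[y [fy y0]].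
apply: (tfX I N0); apply: (fib_inj st cc); first exact: zsubMn.
by rewrite fy; congr (_, _); apply: (hull_inj hullY); rewrite -y0 (addf0 kD).
Qed.

Lemma limit_value_act g a w : A a -> A (act g a) -> limit_value a w ->
  limit_value (act g a) (dactt (tau g) w).
Proof.
move=> Aa Aga [N [N0 NP]]; have [C [cC CP]] := fib_rot st cc g.
have [M [M0 CM]] := constr_mult st cC Aa.
exists (N * M)%N; rewrite muln_gt0 N0; split => // n; have [y [fy wy]] := NP (M * n)%N.
rewrite mulnA in fy wy.
have Cm : C (a *+ (N * M * n)).
  rewrite [(N * M)%N]mulnC -mulnA mulrnA; apply: zsubMn => //; exact: (constr_zsub st cC).
have := CP _ Cm; rewrite (actMn aact) => /(_ (zsubMn sA _ Aga)).
rewrite fy /sd_mul /= mulg1 => -[e1 e2].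
have p1 : (fib (act g a *+ (N * M * n))).2 = 1%g.
  by apply: (mulIg (tau g)); rewrite mul1g.
rewrite p1 (act1 aactt) addrC in e1; move/addrI: e1 => e1.
exists (actt (tau g) y); split; first by rewrite -e1 -p1; exact: surjective_pairing.
by rewrite -(actMn daactt) wy (hull_act hullY).
Qed.

(** The fraction a/m is not canonical, so the extension is a relation first and a function only
    after [rational_value_fun]. *)
Definition rational_value (v : V) (w : W) :=
  exists m a, [/\ (0 < m)%N, A a, v *+ m = j a & limit_value a (w *+ m)].

Lemma rational_value_fun v w w' : rational_value v w -> rational_value v w' -> w = w'.
Proof.
move=> [m [a [m0 Aa va aw]]] [m' [a' [m0' Aa' va' aw']]].
have mm0 : (0 < m * m')%N by rewrite muln_gt0 m0.
have E : a *+ m' = a' *+ m.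
  by apply: (hull_inj hullX); rewrite !(addfMn jD) -va -va' -!mulrnA mulnC.
have r1 := limit_valueMn m' Aa aw; have r2 := limit_valueMn m Aa' aw'; rewrite E in r1.
by apply: (rat_mulIn mm0); have := limit_value_fun r1 r2; rewrite -!mulrnA [(m' * m)%N]mulnC.
Qed.

Lemma rational_value_D v v' w w' : rational_value v w -> rational_value v' w' ->
  rational_value (v + v') (w + w').
Proof.
move=> [m [a [m0 Aa va aw]]] [m' [a' [m0' Aa' va' aw']]].
exists (m * m')%N, (a *+ m' + a' *+ m); split; first by rewrite muln_gt0 m0.
- by apply: zsubD => //; exact: zsubMn.
- by rewrite jD !(addfMn jD) -va -va' mulrnDl -!mulrnA [(m' * m)%N]mulnC.
have -> : (w + w') *+ (m * m') = w *+ m *+ m' + w' *+ m' *+ m.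
  by rewrite mulrnDl -!mulrnA [(m' * m)%N]mulnC.
by apply: limit_valueD; [exact: zsubMn|exact: zsubMn|exact: limit_valueMn|exact: limit_valueMn].
Qed.

Lemma rational_value_act g v w : rational_value v w -> rational_value (dact g v) (dactt (tau g) w).
Proof.
move=> [m [a [m0 Aa va aw]]]; have [N [N0 AN]] := st_sat st (act g a).
exists (m * N)%N, (act g a *+ N); split => //; first by rewrite muln_gt0 m0.
  by rewrite mulrnA -(actMn daact) va (hull_act hullX) (addfMn jD).
rewrite mulrnA -!(actMn daactt) -(actMn aact); apply: limit_value_act.
- exact: zsubMn.
- by rewrite (actMn aact).
- exact: limit_valueMn.
Qed.

Lemma rational_value_inj v : rational_value v 0 -> v = 0.
Proof.
move=> [m [a [m0 Aa va]]]; rewrite mul0rn => /(limit_value_inj Aa) a0.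
by apply: (rat_torsion_free m0); rewrite va a0 (addf0 jD).
Qed.

Lemma rational_value_j a w : A a -> limit_value a w -> rational_value (j a) w.
Proof. by move=> Aa aw; exists 1%N, a. Qed.

Lemma cocycle_embedding : (forall a, A a -> ev_trivial c a) ->
  exists b, is_embedding dact dactt tau b /\ forall a w, A a -> limit_value a w -> b (j a) = w.
Proof.
move=> ev.
have /choice[b bP] v : exists w, rational_value v w.
  have [m [m0 [x vx]]] := hull_cover hullX v; have [N [N0 AN]] := st_sat st x.
  have [w xw] := limit_value_total AN (ev _ AN).
  have mN0 : (0 < m * N)%N by rewrite muln_gt0 m0.
  exists ((m * N)%:R^-1 *: w), (m * N)%N, (x *+ N); split => //.
    by rewrite mulrnA vx (addfMn jD).
  by rewrite -scaler_nat scalerA mulfV ?scale1r // pnatr_eq0 -lt0n.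
have bE v w : rational_value v w -> b v = w by exact: rational_value_fun.
have bD v w : b (v + w) = b v + b w by apply: bE; exact: rational_value_D.
have bI : injective b.
  move=> v w bvw; apply: subr0_eq; apply: rational_value_inj.
  by have := bP (v - w); rewrite (addfB bD) bvw subrr.
have bact g v : b (dact g v) = dactt (tau g) (b v) by apply: bE; exact: rational_value_act.
exists b; split; last by move=> a w Aa aw; apply: bE; exact: rational_value_j.
split; [exact: (tauM st cc)|split; last by []].
(* If tau(g) = tau(h), injectivity of b makes g and h agree on A, and (JF) for C = A gives g = h. *)
move=> g h gh; apply: (mulgI h^-1%g); rewrite mulVg; apply: (st_JF st) => a Aa.
rewrite (actM aact); apply: (act_inj aact (g := h)); rewrite (actVK aact).
apply: (hull_inj hullX); rewrite -!(hull_act hullX); apply: bI.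
by rewrite !bact gh.
Qed.

(** To see that b(j x) lies in k(Y), move x by s s0 to a point where pi is trivial and the multiple
    N = 1 already computes the limit value; then return by tau(s s0)^-1. *)
Lemma cocycle_integral b : is_embedding dact dactt tau b ->
  (forall a w, A a -> limit_value a w -> b (j a) = w) -> cond_star act S A actt T B ->
  exists b0, is_embedding act actt tau b0.
Proof.
move=> [tM [tI [bD [bI bact]]]] bE star.
have /choice[b0 b0P] x : exists y, b (j x) = k y.
  have [_ [_ [_ [_ [_ [SA _]]]]]] := star.
  have [s0 [Ss0 As0]] := SA x.
  have [s [C [Ss cC pm Cm pim]]] := cond_star_small st stt cc tfX hullY star As0.
  have [y fy] : exists y, fib (act s (act s0 x)) = (y, 1%g).
    by exists (fib (act s (act s0 x))).1; rewrite -pim; exact: surjective_pairing.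
  have := limit_value_of_fib (N := 1) cC pm erefl Cm fy; rewrite invr1 scale1r.
  move/(bE _ _ (constr_sub st cC Cm)) => by_.
  exists (actt (tau (s * s0))^-1%g y); rewrite -(hull_act hullY) -by_.
  by rewrite -(actM aact) -(hull_act hullX) bact (actK daactt).
exists b0; split; [exact: tM|split; [exact: tI|split; [|split]]].
- by move=> x y; apply: (hull_inj hullY); rewrite kD -!b0P jD bD.
- by move=> x y; move/(congr1 k); rewrite -!b0P => /bI /(hull_inj hullX).
- by move=> g x; apply: (hull_inj hullY); rewrite -(hull_act hullY) -!b0P -bact (hull_act hullX).
Qed.

End Embedding.

Section OneDirection.
Variables (G : groupType) (X : zmodType) (act : G -> X -> X).
Variables (S : G -> Prop) (A : X -> Prop).
Variables (H : groupType) (Y : zmodType) (actt : H -> Y -> Y).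
Variables (T : H -> Prop) (B : Y -> Prop).
Variables (V : lmodType rat) (j : X -> V) (dact : G -> V -> V).
Variables (W : lmodType rat) (k : Y -> W) (dactt : H -> W -> W).
Hypotheses (st : standing_globalized act S A) (stt : standing_globalized actt T B).
Hypotheses (tfX : torsion_free_on (fun _ : X => True)).
Hypotheses (hullX : rational_hull act j dact) (hullY : rational_hull actt k dactt).
Hypothesis iso : groupoids_isomorphic act S A actt T B.

Lemma rational_embedding : cond_I act S A H -> exists t b, is_embedding dact dactt t b.
Proof.
move=> [Ms [gs I1]]; have [c cc] := iso_cocycle st stt iso.
have ev a : A a -> ev_trivial c a.
  exact: (cond_I_seq_ev_trivial st (st_act stt) cc tfX gs I1).
have [b [bemb _]] := cocycle_embedding st stt cc tfX hullX hullY ev.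
by exists (tau c), b.
Qed.

(** The rational and the integral embedding share the group homomorphism t, so strictness, proved
    over Q through (SF), transfers to the integral one. *)
Lemma integral_embedding : cond_star act S A actt T B ->
  exists t b b0, is_embedding dact dactt t b /\ is_embedding act actt t b0.
Proof.
move=> star; have [c cc] := iso_cocycle st stt iso.
have ev a : A a -> ev_trivial c a.
  exact: (cond_star_ev_trivial st stt cc tfX hullY star).
have [b [bemb bE]] := cocycle_embedding st stt cc tfX hullX hullY ev.
have [b0 b0emb] := cocycle_integral st stt cc tfX hullX hullY bemb bE star.
by exists (tau c), b, b0.
Qed.

End OneDirection.

(** * Consequences of embeddings in both directions *)

Section MutualEmbeddings.
Variables (G H : groupType) (V W : lmodType rat).
Variables (dact : G -> V -> V) (dactt : H -> W -> W).
Variables (t : G -> H) (b : V -> W) (t' : H -> G) (b' : W -> V).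
Hypotheses (emb : is_embedding dact dactt t b) (emb' : is_embedding dactt dact t' b').

Lemma mutual_embedding_full d d' (dec : 'rV[rat]_d -> V) enc (dec' : 'rV[rat]_d' -> W) enc' :
  coordinates dec enc -> coordinates dec' enc' -> emb_full b.
Proof.
move=> cV cW; have [_ [_ [bD [bI _]]]] := emb; have [_ [_ [bD' [bI' _]]]] := emb'.
apply: (injective_dim_full cV cW bD bI); apply/eqP.
by rewrite eqn_leq (injective_dim_le cV cW bD bI) (injective_dim_le cW cV bD' bI').
Qed.

(** The automorphism b b' of W conjugates the action of h into that of t(t'(h)), so (SF) gives
    t(t'(h)) = h. *)
Lemma mutual_embedding_strict : cond_SF dactt -> emb_full b -> emb_full b' -> emb_strict t.
Proof.
move=> SF full full' h; exists (t' h).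
have [_ [_ [bD [bI bact]]]] := emb; have [_ [_ [bD' [bI' bact']]]] := emb'.
have /choice[r rK] w : exists u, b (b' u) = w.
  by have [v <-] := full w; have [u <-] := full' v; exists u.
apply: (SF _ _ (b \o b') r) => [v w|v|v|v] /=.
- by rewrite bD' bD.
- by apply/bI'/bI; rewrite rK.
- exact: rK.
- by rewrite bact' bact rK.
Qed.

End MutualEmbeddings.

Theorem theorem3p30
  (G : groupType) (X : zmodType) (act : G -> X -> X) (S : G -> Prop) (A : X -> Prop)
  (H : groupType) (Y : zmodType) (actt : H -> Y -> Y) (T : H -> Prop) (B : Y -> Prop)
  (V : lmodType rat) (j : X -> V) (dact : G -> V -> V)
  (W : lmodType rat) (k : Y -> W) (dactt : H -> W -> W) :
  standing_globalized act S A ->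
  standing_globalized actt T B ->
  torsion_free_on (fun _ : X => True) ->
  torsion_free_on (fun _ : Y => True) ->
  rational_hull act j dact ->
  rational_hull actt k dactt ->
  let Is := cond_I act S A H /\ cond_I actt T B G in
  let stars := cond_star act S A actt T B /\ cond_star actt T B act S A in
  let iso := groupoids_isomorphic act S A actt T B in
  let finrk := finite_rank (fun _ : X => True) /\ finite_rank (fun _ : Y => True) in
  let SF := cond_SF dact /\ cond_SF dactt in
  (* (i) *)
  (Is -> iso ->
     (exists t b, is_embedding dact dactt t b) /\
     (exists t b, is_embedding dactt dact t b)) /\
  (* (ii) *)
  (stars -> iso ->
     (exists t b, is_embedding act actt t b) /\
     (exists t b, is_embedding actt act t b)) /\
  (* finite rank: (i) with full embeddings *)
  (finrk -> Is -> iso ->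
     (exists t b, is_embedding dact dactt t b /\ emb_full b) /\
     (exists t b, is_embedding dactt dact t b /\ emb_full b)) /\
  (* finite rank: (ii) with finite index embeddings *)
  (finrk -> stars -> iso ->
     (exists t b, is_embedding act actt t b /\ emb_finite_index b) /\
     (exists t b, is_embedding actt act t b /\ emb_finite_index b)) /\
  (* finite rank and (SF): (i) full and strict embedding *)
  (finrk -> SF -> Is -> iso ->
     exists t b, is_embedding dact dactt t b /\ emb_full b /\ emb_strict t) /\
  (* finite rank and (SF): (ii) strict finite index embeddings both ways *)
  (finrk -> SF -> stars -> iso ->
     (exists t b, is_embedding act actt t b /\ emb_finite_index b /\ emb_strict t) /\
     (exists t b, is_embedding actt act t b /\ emb_finite_index b /\ emb_strict t)).
Proof.
move=> st stt tfX tfY hullX hullY Is stars iso finrk SF.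
have rat_emb : Is -> iso -> exists t b t' b',
    is_embedding dact dactt t b /\ is_embedding dactt dact t' b'.
  move=> [I1 I2] i; have i' := groupoids_isomorphic_sym i.
  have [t [b e]] := rational_embedding st stt tfX hullX hullY i I1.
  have [t' [b' e']] := rational_embedding stt st tfY hullY hullX i' I2.
  by exists t, b, t', b'.
have int_emb : stars -> iso -> exists t b b0 t' b' b0',
    [/\ is_embedding dact dactt t b, is_embedding act actt t b0,
        is_embedding dactt dact t' b' & is_embedding actt act t' b0'].
  move=> [s1 s2] i; have i' := groupoids_isomorphic_sym i.
  have [t [b [b0 [e e0]]]] := integral_embedding st stt tfX hullX hullY i s1.
  have [t' [b' [b0' [e' e0']]]] := integral_embedding stt st tfY hullY hullX i' s2.
  by exists t, b, b0, t', b', b0'.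
have full : finrk -> forall t b t' b', is_embedding dact dactt t b ->
    is_embedding dactt dact t' b' -> emb_full b /\ emb_full b'.
  move=> [frX frY] t b t' b' e e'.
  have [d [dec [enc cV]]] := hull_coordinates hullX frX.
  have [d' [dec' [enc' cW]]] := hull_coordinates hullY frY.
  by split; [exact: (mutual_embedding_full e e' cV cW)
            |exact: (mutual_embedding_full e' e cW cV)].
have index : finrk -> forall t b0 t' b0', is_embedding act actt t b0 ->
    is_embedding actt act t' b0' -> emb_finite_index b0 /\ emb_finite_index b0'.
  move=> [frX frY] t b0 t' b0' [_ [_ [bD [bI _]]]] [_ [_ [bD' [bI' _]]]].
  by split; [exact: (finite_index_mutual tfY frY bD bI bD' bI')
            |exact: (finite_index_mutual tfX frX bD' bI' bD bI)].
split; [|split; [|split; [|split; [|split]]]].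
- move=> I1 i; have [t [b [t' [b' [e e']]]]] := rat_emb I1 i.
  by split; [exists t, b|exists t', b'].
- move=> s1 i; have [t [_ [b0 [t' [_ [b0' [_ e _ e']]]]]]] := int_emb s1 i.
  by split; [exists t, b0|exists t', b0'].
- move=> fr I1 i; have [t [b [t' [b' [e e']]]]] := rat_emb I1 i.
  have [fb fb'] := full fr _ _ _ _ e e'.
  by split; [exists t, b|exists t', b'].
- move=> fr s1 i; have [t [_ [b0 [t' [_ [b0' [_ e _ e']]]]]]] := int_emb s1 i.
  have [fb fb'] := index fr _ _ _ _ e e'.
  by split; [exists t, b0|exists t', b0'].
- move=> fr [_ SFY] I1 i; have [t [b [t' [b' [e e']]]]] := rat_emb I1 i.
  have [fb fb'] := full fr _ _ _ _ e e'.
  by exists t, b; do 2!split => //; exact: (mutual_embedding_strict e e').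
- move=> fr [SFX SFY] s1 i; have [t [b [b0 [t' [b' [b0' [e e0 e' e0']]]]]]] := int_emb s1 i.
  have [fb fb'] := full fr _ _ _ _ e e'; have [ib ib'] := index fr _ _ _ _ e0 e0'.
  split; [exists t, b0|exists t', b0']; do 2!split => //.
    exact: (mutual_embedding_strict e e').
  exact: (mutual_embedding_strict e' e).
Qed.
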